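(* Let $\lambda > 1$, $\beta > 0$, and let $\{a_n\}_{n\ge 1}$ be a sequence of real numbers. Assume that $\{a_n\} \in l_2$ if $\beta \le 2$, and that $a_n = o(\lambda^{(2-\beta)n})$ as $n \to \infty$ if $\beta > 2$. Then the dyadic problem with parameters $\lambda,\beta$ and initial data $\{a_n\}$ has a unique Leray-Hopf solution on $[0,\infty)$.
   Context: The dyadic problem with parameters $\lambda>1$, $\beta>0$ and initial data $a=\{a_n\}_{n\ge1}\in l_2$ (real sequences) is $$\dot u_n(t) + \lambda^{2n} u_n(t) - \lambda^{\beta n} u_{n-1}(t)^2 + \lambda^{\beta(n+1)} u_n(t) u_{n+1}(t) = 0,\quad t\in[0,\infty),\qquad u_n(0)=a_n,\qquad n=1,2,\dots,$$ with the convention $u_0\equiv 0$. A weak solution is a sequence $\{u_n\}_{n\ge1}$ of real functions $u_n\in C^\infty[0,\infty)$ satisfying all these equations and initial conditions. A Leray-Hopf solution is a weak solution such that $$\sum_{n=1}^\infty\left(u_n(t)^2 + 2\int_0^t \lambda^{2n}u_n(\tau)^2\,d\tau\right)\le \sum_{n=1}^\infty a_n^2\qquad \forall t\in[0,\infty).$$ *)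

(* Defs.v *)
From Stdlib Require Import Reals.
From Coquelicot Require Import Coquelicot.
Open Scope R_scope.

(* Sequences are indexed by n >= 1: the entry 0 of the data [a] is never used,
   and the entry 0 of a solution [u] is the convention u_0 = 0.  Functions on
   [0, oo) are represented by total functions whose values at negative times
   are never used; in particular the derivatives at t = 0 are one-sided. *)

Definition halfline (t : R) : Prop := 0 <= t.

(* [D_in f d halfline t]: f has derivative [d t] at t within [0, oo). *)
Definition smooth_halfline (f : R -> R) : Prop :=
  exists d : nat -> R -> R,
    (forall t, 0 <= t -> d 0%nat t = f t) /\
    (forall k t, 0 <= t -> D_in (d k) (d (S k)) halfline t).

Definition in_l2 (a : nat -> R) : Prop := ex_series (fun n => a (S n) ^ 2).

(* The sum over n >= 1, with value in [0, +oo], of a series of nonnegative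
   terms: the partial sums are monotone, so [Lim_seq] is their limit. *)
Definition nonneg_sum (f : nat -> R) : Rbar :=
  Lim_seq (fun N => sum_n_m f 1 N).

Definition weak_solution (lambda beta : R) (a : nat -> R) (u : nat -> R -> R)
  : Prop :=
  (forall t, 0 <= t -> u 0%nat t = 0) /\
  (forall n, (1 <= n)%nat ->
     smooth_halfline (u n) /\
     u n 0 = a n /\
     exists du : R -> R, forall t, 0 <= t ->
       D_in (u n) du halfline t /\
       du t + lambda ^ (2 * n) * u n t
         - Rpower lambda (beta * INR n) * u (n - 1)%nat t ^ 2
         + Rpower lambda (beta * INR (n + 1)) * u n t * u (n + 1)%nat t = 0).

Definition Leray_Hopf_solution (lambda beta : R) (a : nat -> R)
    (u : nat -> R -> R) : Prop :=
  weak_solution lambda beta a u /\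
  forall t, 0 <= t ->
    Rbar_le
      (nonneg_sum (fun n =>
         u n t ^ 2 + 2 * RInt (fun tau => lambda ^ (2 * n) * u n tau ^ 2) 0 t))
      (nonneg_sum (fun n => a n ^ 2)).

(* Main.v *)
(* Existence: explicit Euler steps for the system truncated to k modes, with
   mesh sizes so small that the energy error vanishes as k grows.  Every mode obeys
   bounds independent of k, and the tangent estimate
   |u(t) - u(s) - (t - s) F(u(s))| <= C (t - s)^2 is preserved by pointwise
   limits, so the limit along a free ultrafilter solves the equations; the dissipation
   integrals are carried along as additional unknowns.

   Uniqueness: a nonnegative mode stays nonnegative.  While u_n < 0 the energy
   flux into the modes >= n is negative, so the Leray-Hopf inequality gives
   u_n >= - e_n, where e_n^2 is the sum of a_m^2 over m >= n; the assumption on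
   the data says lambda^(beta n) e_n = o(lambda^(2 n)).  Testing the equations
   with u_{n+1} and u_n and iterating the resulting inequality over n bounds
   lambda^(beta n) times the integral of |u_n|^3 uniformly in n.  For two
   solutions with difference w and sum s, in the derivative of
   sum_{n <= N} 2^(-n) w_n^2 the cross terms telescope: what remains is a
   quadratic form that the viscosity controls thanks to s_n >= - 2 e_n, and a
   boundary term that the cubic bound makes O(2^(-N)).  Gronwall's inequality
   and N -> oo conclude. *)

Require Import Defs.
From Stdlib Require Import Reals ZArith Lra Lia Psatz ClassicalEpsilon Bool.
From Coquelicot Require Import Coquelicot.
From mathcomp Require filter.
Open Scope R_scope.

(** * Finite sums and the energy balance *)

(** The equation of mode [n] solved for its derivative. The coefficients stay abstract: [p n] stands
    for lambda^(2 n) and [q n] for lambda^(beta n). Existence rests on their signs, uniqueness also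
    on their geometric growth. *)
Definition dyadic_rhs (p q x : nat -> R) (n : nat) : R :=
  - p n * x n + q n * x (n - 1)%nat ^ 2 - q (n + 1)%nat * x n * x (n + 1)%nat.

Definition sum1 (f : nat -> R) (N : nat) : R := sum_n_m f 1 N.

Lemma sum1_0 (f : nat -> R) : sum1 f 0 = 0.
Proof. now unfold sum1; rewrite sum_n_m_zero by lia. Qed.

Lemma sum1_S (f : nat -> R) (N : nat) :
  sum1 f (S N) = sum1 f N + f (S N).
Proof. unfold sum1; rewrite sum_n_Sm by lia; reflexivity. Qed.

Lemma sum1_ext (f g : nat -> R) (N : nat) :
  (forall n, (1 <= n <= N)%nat -> f n = g n) -> sum1 f N = sum1 g N.
Proof. intros H; apply sum_n_m_ext_loc; exact H. Qed.

Lemma sum1_lin (f g : nat -> R) (k : R) (N : nat) :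
  sum1 (fun n => f n + k * g n) N = sum1 f N + k * sum1 g N.
Proof.
induction N as [|N IH]; [rewrite !sum1_0; ring|].
rewrite !sum1_S, IH; ring.
Qed.

Lemma sum1_le (f g : nat -> R) (N : nat) :
  (forall n, (1 <= n <= N)%nat -> f n <= g n) -> sum1 f N <= sum1 g N.
Proof.
induction N as [|N IH]; intros H; [rewrite !sum1_0; lra|].
rewrite !sum1_S; apply Rplus_le_compat; [apply IH|]; intros; apply H; lia.
Qed.

Lemma sum1_ge0 (f : nat -> R) (N : nat) :
  (forall n, (1 <= n <= N)%nat -> 0 <= f n) -> 0 <= sum1 f N.
Proof.
induction N as [|N IH]; intros H; [rewrite sum1_0; lra|].
rewrite sum1_S; apply Rplus_le_le_0_compat; [apply IH; intros|]; apply H; lia.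
Qed.

Lemma sum1_mono (f : nat -> R) (M N : nat) :
  (forall n, (1 <= n)%nat -> 0 <= f n) -> (M <= N)%nat ->
  sum1 f M <= sum1 f N.
Proof.
intros H HMN; induction HMN as [|N HMN IH]; [lra|].
rewrite sum1_S; specialize (H (S N) ltac:(lia)); lra.
Qed.

Lemma sum1_term_le (f : nat -> R) (m N : nat) :
  (forall n, (1 <= n)%nat -> 0 <= f n) -> (1 <= m <= N)%nat ->
  f m <= sum1 f N.
Proof.
intros H Hm; apply Rle_trans with (sum1 f m).
- destruct m as [|m]; [lia|]; rewrite sum1_S.
  assert (0 <= sum1 f m) by (apply sum1_ge0; intros; apply H; lia); lra.
- now apply sum1_mono.
Qed.

(** The nonlinear terms telescope: what mode n gains from mode n - 1 is exactly what mode n - 1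
    loses. Only the flux out of mode [N] survives, and [x 0 = 0] closes the sum at the lower end. *)
Lemma energy_flux (p q x : nat -> R) (N : nat) :
  x 0%nat = 0 ->
  sum1 (fun n => 2 * x n * dyadic_rhs p q x n) N =
  - 2 * sum1 (fun n => p n * x n ^ 2) N
  - 2 * q (S N) * x N ^ 2 * x (S N).
Proof.
intros Hx; induction N as [|N IH]; [rewrite !sum1_0, Hx; ring|].
rewrite !sum1_S, IH; unfold dyadic_rhs.
replace (S N - 1)%nat with N by lia.
replace (S N + 1)%nat with (S (S N)) by lia.
ring.
Qed.

(** * Limits along a free ultrafilter *)

(** The ultrafilter lemma of mathcomp, applied to [eventually] and translated between the two
    notions of filter. One ultrafilter makes all modes converge at all times at once, in place of a
    diagonal choice of subsequences. *)
Lemma exists_free_ultrafilter :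
  exists U : (nat -> Prop) -> Prop,
    ProperFilter U /\ filter_le U eventually /\
    forall P : nat -> Prop, U P \/ U (fun k => ~ P k).
Proof.
assert (HE : filter.ProperFilter eventually).
{ constructor.
  - intros [N HN]; exact (HN N (le_n N)).
  - constructor; [exists 0%nat; easy| |].
    + exact (@filter_and _ _ (@filter_filter _ _ eventually_filter)).
    + exact (@filter_imp _ _ (@filter_filter _ _ eventually_filter)). }
destruct (filter.ultraFilterLemma HE) as [U [HU HUE]].
exists U; split; [|split].
- pose proof HU as [[H0 [H1 H2 H3]] _].
  constructor.
  (* Coquelicot wants every member of the filter inhabited, mathcomp only excludes the empty set;
     classical logic bridges the two. *)
  + intros P HP; apply NNPP; intros HN; apply H0.
    apply H3 with P; [|exact HP]; intros k Hk; apply HN; now exists k.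
  + constructor; [exact H1 | exact H2 | exact H3].
- exact HUE.
- intros P; exact (filter.in_ultra_setVsetC P HU).
Qed.

Section UltrafilterLimit.

Variable U : (nat -> Prop) -> Prop.
Context {HU : ProperFilter U}.
Hypothesis U_free : filter_le U eventually.
Hypothesis U_ultra : forall P : nat -> Prop, U P \/ U (fun k => ~ P k).

Definition utends (s : nat -> R) (l : R) : Prop := filterlim s U (locally l).

Lemma utends_iff (s : nat -> R) (l : R) :
  utends s l <-> forall eps : posreal, U (fun k => Rabs (s k - l) < eps).
Proof. exact (@filterlim_locally _ R_UniformSpace U _ s l). Qed.

(** The limit is the supremum of the levels that the sequence reaches on a set of [U]. *)
Lemma utends_bounded (s : nat -> R) (B : R) :
  U (fun k => Rabs (s k) <= B) -> exists l, utends s l.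
Proof.
intros HB.
destruct (completeness (fun x => U (fun k => x <= s k))) as [l [Hub Hlub]].
- exists B; intros x Hx.
  destruct (filter_ex _ (filter_and _ _ HB Hx)) as [k [H1 H2]].
  apply Rabs_le_between in H1; lra.
- exists (- B); revert HB; apply filter_imp; intros k Hk.
  apply Rabs_le_between in Hk; lra.
- exists l; apply utends_iff; intros [eps Heps]; simpl.
  assert (Hlo : U (fun k => l - eps < s k)).
  { apply NNPP; intros HN.
    apply (Rlt_irrefl l); apply Rle_lt_trans with (l - eps); [|lra].
    apply Hlub; intros x Hx; apply Rnot_lt_le; intros Hlt; apply HN.
    revert Hx; apply filter_imp; intros k Hk; lra. }
  assert (Hhi : U (fun k => s k < l + eps)).
  (* Only here does maximality matter: if [s k < l + eps] fails to be large, its complement is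
     large, and [l + eps] would be a level above the supremum. *)
  { destruct (U_ultra (fun k => s k < l + eps)) as [H|H]; [exact H|exfalso].
    assert (l + eps <= l); [|lra].
    apply Hub; revert H; apply filter_imp; intros k Hk; lra. }
  generalize (filter_and _ _ Hlo Hhi); apply filter_imp.
  intros k [H1 H2]; apply Rabs_def1; lra.
Qed.

(** A total choice of limit, so that candidate solutions can be defined before any bound is proved;
    it is meaningful for sequences bounded along [U]. *)
Definition ulim (s : nat -> R) : R := epsilon (inhabits 0) (utends s).

Lemma ulim_spec (s : nat -> R) (B : R) :
  U (fun k => Rabs (s k) <= B) -> utends s (ulim s).
Proof.
intros HB.
exact (epsilon_spec (inhabits 0) (utends s) (utends_bounded s B HB)).
Qed.

Lemma utends_const (c : R) : utends (fun _ => c) c.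
Proof. apply (filterlim_const (F := U)). Qed.

Lemma utends_plus (s t : nat -> R) (a b : R) :
  utends s a -> utends t b -> utends (fun k => s k + t k) (a + b).
Proof.
intros Hs Ht; eapply (filterlim_comp_2 (F := U)); [exact Hs|exact Ht|].
apply (filterlim_plus (V := R_NormedModule) a b).
Qed.

Lemma utends_mult (s t : nat -> R) (a b : R) :
  utends s a -> utends t b -> utends (fun k => s k * t k) (a * b).
Proof.
intros Hs Ht; eapply (filterlim_comp_2 (F := U)); [exact Hs|exact Ht|].
apply (filterlim_mult (K := R_AbsRing) a b).
Qed.

Lemma utends_opp (s : nat -> R) (a : R) :
  utends s a -> utends (fun k => - s k) (- a).
Proof.
intros Hs; eapply (filterlim_comp _ _ _ s Ropp); [exact Hs|].
apply (filterlim_opp (V := R_NormedModule) a).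
Qed.

Lemma utends_abs (s : nat -> R) (a : R) :
  utends s a -> utends (fun k => Rabs (s k)) (Rabs a).
Proof.
intros Hs; eapply (filterlim_comp _ _ _ s Rabs); [exact Hs|].
apply (filterlim_Rabs a).
Qed.

Lemma utends_minus (s t : nat -> R) (a b : R) :
  utends s a -> utends t b -> utends (fun k => s k - t k) (a - b).
Proof. intros Hs Ht; now apply utends_plus; [|apply utends_opp]. Qed.

Lemma utends_pow (s : nat -> R) (a : R) (m : nat) :
  utends s a -> utends (fun k => s k ^ m) (a ^ m).
Proof.
intros Hs; induction m as [|m IH]; simpl; [apply utends_const|].
now apply utends_mult.
Qed.

Lemma utends_le (s t : nat -> R) (a b : R) :
  utends s a -> utends t b -> U (fun k => s k <= t k) -> a <= b.
Proof.
intros Hs Ht H.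
exact (filterlim_le (F := U) s t (Finite a) (Finite b) H Hs Ht).
Qed.

Lemma utends_is_lim_seq (s : nat -> R) (l : R) : is_lim_seq s l -> utends s l.
Proof. intros H; apply (filterlim_filter_le_1 _ U_free); exact H. Qed.

Lemma utends_sum1 (s : nat -> nat -> R) (l : nat -> R) (N : nat) :
  (forall n, (1 <= n <= N)%nat -> utends (fun k => s k n) (l n)) ->
  utends (fun k => sum1 (s k) N) (sum1 l N).
Proof.
induction N as [|N IH]; intros H.
- rewrite sum1_0; apply filterlim_ext with (fun _ : nat => 0);
    [intros; now rewrite sum1_0 | apply utends_const].
- rewrite sum1_S.
  apply filterlim_ext with (fun k => sum1 (s k) N + s k (S N));
    [intros; now rewrite sum1_S|].
  apply utends_plus; [apply IH; intros|]; apply H; lia.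
Qed.

Lemma U_large (K : nat) : U (fun k => (K <= k)%nat).
Proof. apply U_free; now exists K. Qed.

End UltrafilterLimit.

(** * Limits of Euler schemes *)

(** The number of the last node of the grid of mesh [h] at or before time [t]. *)
Definition grid_index (h t : R) : nat := Z.to_nat (Int_part (t / h)).

Lemma grid_index_bounds (h t : R) :
  0 < h -> 0 <= t ->
  INR (grid_index h t) * h <= t < INR (grid_index h t) * h + h.
Proof.
intros Hh Ht; unfold grid_index.
assert (Hth : 0 <= t / h) by (apply Rdiv_le_0_compat; lra).
destruct (base_Int_part (t / h)) as [H1 H2].
assert (Hz : (0 <= Int_part (t / h))%Z).
{ assert (-1 < Int_part (t / h))%Z; [apply lt_IZR|]; simpl; lra || lia. }
rewrite INR_IZR_INZ, Z2Nat.id by exact Hz.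
replace t with (t / h * h) at 2 3 by (field; lra).
split; nra.
Qed.

Lemma grid_index_0 (h : R) : 0 < h -> grid_index h 0 = 0%nat.
Proof.
intros Hh; destruct (grid_index_bounds h 0 Hh (Rle_refl 0)) as [H _].
destruct (grid_index h 0) as [|n]; [reflexivity|exfalso].
rewrite S_INR in H; pose proof (pos_INR n); nra.
Qed.

Lemma grid_index_le (h s t : R) :
  0 < h -> 0 <= s -> s <= t -> (grid_index h s <= grid_index h t)%nat.
Proof.
intros Hh Hs Hst.
destruct (grid_index_bounds h s Hh Hs) as [H1 _].
destruct (grid_index_bounds h t Hh ltac:(lra)) as [_ H2].
apply Nat.lt_succ_r, INR_lt; rewrite S_INR; nra.
Qed.

Lemma euler_increment (h c : R) (y f : nat -> R) (j m : nat) :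
  0 <= h -> (forall i, y (S i) = y i + h * f i) ->
  (forall i, (i < m)%nat -> Rabs (f (j + i)%nat) <= c) ->
  Rabs (y (j + m)%nat - y j) <= c * (INR m * h).
Proof.
intros Hh Hy; induction m as [|m IH]; intros Hf.
- rewrite Nat.add_0_r, Rminus_diag, Rabs_R0; simpl; lra.
- rewrite <- plus_n_Sm, Hy, S_INR.
  specialize (IH ltac:(intros; apply Hf; lia)).
  specialize (Hf m ltac:(lia)).
  apply Rabs_le_between in IH; apply Rabs_le_between in Hf.
  apply Rabs_le_between; split; nra.
Qed.

(** Step m adds an error of at most h L (m h), and these add up to at most L (m h)^2. *)
Lemma euler_tangent (h L : R) (y f : nat -> R) (j m : nat) :
  0 <= h -> 0 <= L -> (forall i, y (S i) = y i + h * f i) ->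
  (forall i, (i < m)%nat -> Rabs (f (j + i)%nat - f j) <= L * (INR i * h)) ->
  Rabs (y (j + m)%nat - y j - INR m * h * f j) <= L * (INR m * h) ^ 2.
Proof.
intros Hh HL Hy; induction m as [|m IH]; intros Hf.
- rewrite Nat.add_0_r; simpl.
  replace (y j - y j - 0 * h * f j) with 0 by ring; rewrite Rabs_R0; lra.
- rewrite <- plus_n_Sm, Hy, S_INR.
  specialize (IH ltac:(intros; apply Hf; lia)).
  specialize (Hf m ltac:(lia)).
  replace (y (j + m)%nat + h * f (j + m)%nat - y j - (INR m + 1) * h * f j)
    with ((y (j + m)%nat - y j - INR m * h * f j) + h * (f (j + m)%nat - f j))
    by ring.
  eapply Rle_trans; [apply Rabs_triang|].
  rewrite Rabs_mult, (Rabs_pos_eq h) by exact Hh.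
  pose proof (pos_INR m).
  apply Rle_trans with (L * (INR m * h) ^ 2 + h * (L * (INR m * h))).
  { apply Rplus_le_compat; [exact IH|now apply Rmult_le_compat_l]. }
  (* This is the slack in the induction, since (m + 1)^2 - m^2 - m = m + 1. *)
  assert (0 <= L * (h * h) * (INR m + 1)); [|nra].
  repeat apply Rmult_le_pos; lra.
Qed.

(** The hypotheses only look forward in time. A backward increment is expanded at its left end, and
    moving the slope to the right end costs another [L * (t - x) ^ 2], whence the factor 2. *)
Lemma D_in_of_quadratic_error (Y F : R -> R) (L : R) :
  (forall s t, 0 <= s -> s <= t -> Rabs (F t - F s) <= L * (t - s)) ->
  (forall s t, 0 <= s -> s <= t ->
     Rabs (Y t - Y s - (t - s) * F s) <= L * (t - s) ^ 2) ->
  forall t, 0 <= t -> D_in Y F halfline t.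
Proof.
intros HF HY t Ht.
assert (HL : 0 <= L).
{ specialize (HF 0 1 ltac:(lra) ltac:(lra)).
  pose proof (Rabs_pos (F 1 - F 0)); lra. }
assert (Hq : forall x, 0 <= x ->
  Rabs (Y x - Y t - (x - t) * F t) <= 2 * L * (x - t) ^ 2).
{ intros x Hx; destruct (Rle_lt_dec t x) as [Hle|Hlt].
  - specialize (HY t x Ht Hle); pose proof (pow2_ge_0 (x - t)); nra.
  - specialize (HY x t Hx ltac:(lra)); specialize (HF x t Hx ltac:(lra)).
    replace (Y x - Y t - (x - t) * F t)
      with (- (Y t - Y x - (t - x) * F x) + (t - x) * (F t - F x)) by ring.
    eapply Rle_trans; [apply Rabs_triang|].
    rewrite Rabs_Ropp, Rabs_mult, (Rabs_pos_eq (t - x)) by lra.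
    nra. }
intros eps Heps.
(* The summand 1 keeps the denominator positive when [L = 0]. *)
exists (eps / (2 * L + 1)); split; [apply Rdiv_lt_0_compat; lra|].
intros x [[Hx Hne] Hd].
simpl in Hd |- *; unfold Rdist, halfline in *.
assert (Hxt : x - t <> 0) by lra.
assert (Hpos : 0 < Rabs (x - t)) by now apply Rabs_pos_lt.
specialize (Hq x Hx).
replace ((Y x - Y t) / (x - t) - F t)
  with ((Y x - Y t - (x - t) * F t) / (x - t)) by (field; exact Hxt).
unfold Rdiv; rewrite Rabs_mult, Rabs_inv.
apply Rmult_lt_reg_r with (Rabs (x - t)); [exact Hpos|].
rewrite Rmult_assoc, Rinv_l, Rmult_1_r by lra.
rewrite <- pow2_abs in Hq.
apply (Rmult_lt_compat_r (2 * L + 1)) in Hd; [|lra].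
replace (eps / (2 * L + 1) * (2 * L + 1)) with eps in Hd by (field; lra).
nra.
Qed.

Section EulerLimit.

Variable U : (nat -> Prop) -> Prop.
Context {HU : ProperFilter U}.
Hypothesis U_free : filter_le U eventually.

(** The two estimates of [D_in_of_quadratic_error] hold for the schemes up to errors of order [h k],
    and non-strict inequalities survive the limit. The bounds are asked only up to time [INR k + 1],
    a horizon that eventually passes any fixed [t], and only from [K] on, when the mode in question
    belongs to the truncation. *)
Lemma euler_limit_D_in (h : nat -> R) (y f : nat -> nat -> R)
    (Y F : R -> R) (c L : R) (K : nat) :
  0 <= L -> (forall k, 0 < h k) -> is_lim_seq h 0 ->
  (forall k, (K <= k)%nat ->
     (forall j, y k (S j) = y k j + h k * f k j) /\
     (forall j, INR j * h k <= INR k + 1 -> Rabs (f k j) <= c) /\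
     (forall j i, INR (j + i) * h k <= INR k + 1 ->
        Rabs (f k (j + i)%nat - f k j) <= L * (INR i * h k))) ->
  (forall t, 0 <= t -> utends U (fun k => y k (grid_index (h k) t)) (Y t)) ->
  (forall t, 0 <= t -> utends U (fun k => f k (grid_index (h k) t)) (F t)) ->
  forall t, 0 <= t -> D_in Y F halfline t.
Proof.
intros HL Hh Hh0 Hsys HY HF.
assert (Hhu : utends U h 0) by now apply utends_is_lim_seq.
assert (Hgrid : forall s t k, 0 <= s -> s <= t -> t <= INR k + 1 ->
  exists m, grid_index (h k) t = (grid_index (h k) s + m)%nat /\
    INR (grid_index (h k) s + m) * h k <= INR k + 1 /\
    t - s - h k <= INR m * h k <= t - s + h k).
{ intros s t k Hs Hst Hk; exists (grid_index (h k) t - grid_index (h k) s)%nat.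
  pose proof (grid_index_le (h k) s t (Hh k) Hs Hst) as Hle.
  pose proof (grid_index_bounds (h k) s (Hh k) Hs) as Bs.
  pose proof (grid_index_bounds (h k) t (Hh k) ltac:(lra)) as Bt.
  replace (grid_index (h k) s + (grid_index (h k) t - grid_index (h k) s))%nat
    with (grid_index (h k) t) by lia.
  rewrite minus_INR by exact Hle.
  repeat split; lra. }
assert (Hev : forall t, U (fun k => (K <= k)%nat /\ t <= INR k + 1)).
{ intros t; apply filter_and; [now apply U_large|].
  destruct (nfloor_ex (Rmax 0 t) (Rmax_l _ _)) as [n Hn].
  eapply filter_imp; [|exact (U_large U U_free n)].
  intros k Hk; apply le_INR in Hk; pose proof (Rmax_r 0 t); lra. }
apply D_in_of_quadratic_error with L.
- intros s t Hs Hst.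
  apply (utends_le U
    (fun k => Rabs (f k (grid_index (h k) t) - f k (grid_index (h k) s)))
    (fun k => L * (t - s + h k))).
  + apply (utends_abs U), (utends_minus U); apply HF; lra.
  + replace (L * (t - s)) with (L * (t - s + 0)) by ring.
    now apply (utends_mult U); [apply (utends_const U)|apply (utends_plus U);
      [apply (utends_const U)|]].
  + eapply filter_imp; [|exact (Hev t)].
    intros k [HkK Hk]; destruct (Hsys k HkK) as [_ [_ Hlip]].
    destruct (Hgrid s t k Hs Hst Hk) as [m [-> [Hm1 Hm2]]].
    eapply Rle_trans; [now apply Hlip|].
    apply Rmult_le_compat_l; lra.
- intros s t Hs Hst.
  apply (utends_le U
    (fun k => Rabs (y k (grid_index (h k) t) - y k (grid_index (h k) s)
                    - (t - s) * f k (grid_index (h k) s)))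
    (fun k => L * (t - s + h k) ^ 2 + c * h k)).
  + apply (utends_abs U), (utends_minus U);
      [apply (utends_minus U); apply HY; lra|].
    apply (utends_mult U); [apply (utends_const U)|apply HF; lra].
  + replace (L * (t - s) ^ 2) with (L * (t - s + 0) ^ 2 + c * 0) by ring.
    apply (utends_plus U); apply (utends_mult U); try apply (utends_const U);
      [|exact Hhu].
    apply (utends_pow U), (utends_plus U); [apply (utends_const U)|exact Hhu].
  + eapply filter_imp; [|exact (Hev t)].
    intros k [HkK Hk]; destruct (Hsys k HkK) as [Hy [Hc Hlip]].
    destruct (Hgrid s t k Hs Hst Hk) as [m [-> [Hm1 Hm2]]].
    set (j := grid_index (h k) s) in *.
    pose proof (Hh k) as Hhk.
    assert (Htan : Rabs (y k (j + m)%nat - y k j - INR m * h k * f k j)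
                   <= L * (INR m * h k) ^ 2).
    { apply euler_tangent; try assumption; [lra|].
      intros i Hi; apply Hlip.
      eapply Rle_trans; [|exact Hm1].
      apply Rmult_le_compat_r; [lra|apply le_INR; lia]. }
    assert (Hcj : Rabs (f k j) <= c).
    { apply Hc; eapply Rle_trans; [|exact Hm1].
      apply Rmult_le_compat_r; [lra|apply le_INR; lia]. }
    (* The elapsed grid time differs from [t - s] by at most one mesh, which costs [c * h k]. *)
    replace (y k (j + m)%nat - y k j - (t - s) * f k j)
      with ((y k (j + m)%nat - y k j - INR m * h k * f k j)
            + (INR m * h k - (t - s)) * f k j) by ring.
    eapply Rle_trans; [apply Rabs_triang|]; apply Rplus_le_compat.
    * eapply Rle_trans; [exact Htan|].
      apply Rmult_le_compat_l; [exact HL|].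
      apply pow_incr; split; [|lra].
      apply Rmult_le_pos; [apply pos_INR|lra].
    * rewrite Rabs_mult, Rmult_comm.
      apply Rmult_le_compat; try apply Rabs_pos; [exact Hcj|].
      apply Rabs_le_between; lra.
Qed.

End EulerLimit.

(** * Energy bounds for the truncated system *)

Section Galerkin.

Variables p q a : nat -> R.
Variable l : R.
Hypothesis p_ge0 : forall n, 0 <= p n.
Hypothesis q_ge0 : forall n, 0 <= q n.
Hypothesis a_le : forall N, sum1 (fun n => a n ^ 2) N <= l.

Definition galerkin_mode (N n : nat) : bool := ((1 <=? n) && (n <=? N))%nat.

Lemma galerkin_mode_true (N n : nat) :
  (1 <= n <= N)%nat -> galerkin_mode N n = true.
Proof.
intros [H1 H2]; unfold galerkin_mode.
now rewrite (proj2 (Nat.leb_le _ _) H1), (proj2 (Nat.leb_le _ _) H2).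
Qed.

Lemma galerkin_mode_false (N n : nat) :
  (n = 0 \/ N < n)%nat -> galerkin_mode N n = false.
Proof.
intros [->|H]; [reflexivity|]; unfold galerkin_mode.
now rewrite (proj2 (Nat.leb_gt _ _) H), andb_false_r.
Qed.

(** Modes outside 1..[N] are held at 0, which realises both the truncation and the convention u_0 =
    0, so that [dyadic_rhs] applies unchanged at both ends. *)
Fixpoint euler (N : nat) (h : R) (j n : nat) : R :=
  if galerkin_mode N n then
    match j with
    | O => a n
    | S j' => euler N h j' n + h * dyadic_rhs p q (euler N h j') n
    end
  else 0.

(** The left Riemann sum of the dissipation integral, treated as one more Euler unknown so that its
    limit satisfies a differential equation too. *)
Fixpoint euler_dissipation (N : nat) (h : R) (j n : nat) : R :=
  match j with
  | O => 0
  | S j' => euler_dissipation N h j' n + h * (p n * euler N h j' n ^ 2)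
  end.

Lemma euler_step (N : nat) (h : R) (j n : nat) :
  (1 <= n <= N)%nat ->
  euler N h (S j) n = euler N h j n + h * dyadic_rhs p q (euler N h j) n.
Proof. intros Hn; simpl; now rewrite galerkin_mode_true. Qed.

Lemma euler_init (N : nat) (h : R) (n : nat) :
  (1 <= n <= N)%nat -> euler N h 0 n = a n.
Proof. intros Hn; simpl; now rewrite galerkin_mode_true. Qed.

Lemma euler_out (N : nat) (h : R) (j n : nat) :
  (n = 0 \/ N < n)%nat -> euler N h j n = 0.
Proof. intros Hn; destruct j; simpl; now rewrite galerkin_mode_false. Qed.

Lemma euler_dissipation_ge0 (N : nat) (h : R) (j n : nat) :
  0 <= h -> 0 <= euler_dissipation N h j n.
Proof.
intros Hh; induction j as [|j IH]; simpl; [lra|].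
apply Rplus_le_le_0_compat; [exact IH|].
apply Rmult_le_pos; [exact Hh|]; apply Rmult_le_pos; [apply p_ge0|].
apply pow2_ge_0.
Qed.

(* [l + 1] bounds the modes as long as the energy error of the explicit scheme
   is at most 1, since [l + 1 <= (l + 1) ^ 2]. *)
Definition rhs_bound (n : nat) : R :=
  p n * (l + 1) + q n * (l + 1) ^ 2 + q (n + 1)%nat * (l + 1) ^ 2.

Definition rhs_energy_bound (N : nat) : R := sum1 (fun n => rhs_bound n ^ 2) N.

Lemma l_ge0 : 0 <= l.
Proof. specialize (a_le 0); rewrite sum1_0 in a_le; exact a_le. Qed.

Lemma rhs_bound_ge0 (n : nat) : 0 <= rhs_bound n.
Proof.
pose proof l_ge0; unfold rhs_bound.
repeat apply Rplus_le_le_0_compat; apply Rmult_le_pos;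
  try apply p_ge0; try apply q_ge0; try apply pow2_ge_0; lra.
Qed.

Lemma dyadic_rhs_bounded (x : nat -> R) (n : nat) :
  (forall m, Rabs (x m) <= l + 1) -> Rabs (dyadic_rhs p q x n) <= rhs_bound n.
Proof.
intros Hx; unfold dyadic_rhs, rhs_bound.
pose proof l_ge0; set (R0 := l + 1) in *.
assert (HR0 : 0 <= R0) by (unfold R0; lra).
eapply Rle_trans; [apply Rabs_triang|]; apply Rplus_le_compat.
- eapply Rle_trans; [apply Rabs_triang|]; apply Rplus_le_compat.
  + rewrite Rabs_mult, Rabs_Ropp, (Rabs_pos_eq (p n)) by apply p_ge0.
    apply Rmult_le_compat_l; [apply p_ge0|apply Hx].
  + rewrite Rabs_mult, (Rabs_pos_eq (q n)) by apply q_ge0.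
    apply Rmult_le_compat_l; [apply q_ge0|].
    rewrite <- RPow_abs; apply pow_incr; split; [apply Rabs_pos|apply Hx].
- rewrite Rabs_Ropp, !Rabs_mult, (Rabs_pos_eq (q _)) by apply q_ge0.
  rewrite Rmult_assoc; apply Rmult_le_compat_l; [apply q_ge0|].
  simpl; rewrite Rmult_1_r; apply Rmult_le_compat; try apply Rabs_pos; apply Hx.
Qed.

Definition euler_energy (N : nat) (h : R) (j : nat) : R :=
  sum1 (fun n => euler N h j n ^ 2 + 2 * euler_dissipation N h j n) N.

Lemma euler_bounded_of_energy (N : nat) (h : R) (j m : nat) :
  0 <= h -> euler_energy N h j <= l + 1 -> Rabs (euler N h j m) <= l + 1.
Proof.
intros Hh HE; pose proof l_ge0.
destruct (le_lt_dec 1 m) as [H1|H1];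
  [destruct (le_lt_dec m N) as [H2|H2]|];
  try (rewrite euler_out, Rabs_R0 by lia; lra).
assert (Hterm : euler N h j m ^ 2 + 2 * euler_dissipation N h j m
                <= euler_energy N h j).
{ apply (sum1_term_le
    (fun n => euler N h j n ^ 2 + 2 * euler_dissipation N h j n)); [|lia].
  intros n _; pose proof (pow2_ge_0 (euler N h j n)).
  pose proof (euler_dissipation_ge0 N h j n Hh); lra. }
pose proof (euler_dissipation_ge0 N h j m Hh).
apply Rabs_le; split; nra.
Qed.

(** Expanding the squares in one step, the first-order terms cancel against the dissipation by
    [energy_flux], as mode [N + 1] vanishes; what is left is h^2 times the square of the right-hand
    side. The argument is a bootstrap: while the accumulated error is at most 1, the modes obey the
    bound [l + 1] under which that square was estimated. *)
Lemma euler_energy_le (N : nat) (h : R) (j : nat) :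
  0 <= h -> INR j * (h * h * rhs_energy_bound N) <= 1 ->
  euler_energy N h j <= l + INR j * (h * h * rhs_energy_bound N).
Proof.
intros Hh.
assert (HC : 0 <= h * h * rhs_energy_bound N).
{ apply Rmult_le_pos; [nra|apply sum1_ge0; intros; apply pow2_ge_0]. }
induction j as [|j IH]; intros Hj.
- replace (l + _) with l by (simpl; ring).
  eapply Rle_trans; [|exact (a_le N)]; apply sum1_le; intros n Hn.
  rewrite euler_init by exact Hn; simpl; lra.
- rewrite S_INR in *; specialize (IH ltac:(lra)).
  set (x := euler N h j) in *.
  assert (Hx : forall m, Rabs (x m) <= l + 1)
    by (intros m; apply euler_bounded_of_energy; lra).
  assert (HF : sum1 (fun n => dyadic_rhs p q x n ^ 2) N <= rhs_energy_bound N).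
  { apply sum1_le; intros n _; rewrite <- pow2_abs.
    apply pow_incr; split; [apply Rabs_pos|now apply dyadic_rhs_bounded]. }
  assert (Heq : euler_energy N h (S j) =
    euler_energy N h j + h * sum1 (fun n => 2 * x n * dyadic_rhs p q x n) N
    + 2 * h * sum1 (fun n => p n * x n ^ 2) N
    + h * h * sum1 (fun n => dyadic_rhs p q x n ^ 2) N).
  { unfold euler_energy; rewrite <- !sum1_lin; apply sum1_ext; intros n Hn.
    rewrite euler_step by exact Hn; simpl euler_dissipation; fold x; ring. }
  rewrite Heq, energy_flux by (apply euler_out; lia).
  replace (x (S N)) with 0 by (symmetry; apply euler_out; lia).
  apply (Rmult_le_compat_l (h * h)) in HF; [|nra].
  lra.
Qed.

(** * Choice of the mesh and bounds uniform in the truncation *)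

(** With this mesh the energy error up to time s is at most s / (k + 1): never above 1 before time k
    + 1, and vanishing as k grows for fixed s. *)
Definition euler_mesh (k : nat) : R :=
  / ((INR k + 1) * (rhs_energy_bound k + 1)).

Lemma rhs_energy_bound_ge0 (N : nat) : 0 <= rhs_energy_bound N.
Proof. apply sum1_ge0; intros; apply pow2_ge_0. Qed.

Lemma euler_mesh_pos (k : nat) : 0 < euler_mesh k.
Proof.
apply Rinv_0_lt_compat; pose proof (pos_INR k).
pose proof (rhs_energy_bound_ge0 k); nra.
Qed.

Lemma euler_mesh_error (k : nat) (s : R) :
  0 <= s ->
  s * (euler_mesh k * rhs_energy_bound k) <= s * / (INR k + 1).
Proof.
intros Hs; apply Rmult_le_compat_l; [exact Hs|]; unfold euler_mesh.
pose proof (pos_INR k); pose proof (rhs_energy_bound_ge0 k).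
rewrite Rinv_mult, Rmult_assoc.
apply Rle_trans with (/ (INR k + 1) * 1); [|lra].
apply Rmult_le_compat_l; [left; apply Rinv_0_lt_compat; lra|].
apply Rmult_le_reg_l with (rhs_energy_bound k + 1); [lra|].
rewrite <- Rmult_assoc, Rinv_r by lra; lra.
Qed.

Lemma is_lim_seq_inv_INR_succ : is_lim_seq (fun k => / (INR k + 1)) 0.
Proof.
apply is_lim_seq_ext with (fun k => / INR (S k)).
{ intros k; now rewrite S_INR. }
apply (is_lim_seq_inv (fun k => INR (S k)) p_infty);
  [apply (is_lim_seq_incr_1 INR), is_lim_seq_INR | easy].
Qed.

Lemma euler_mesh_lim : is_lim_seq euler_mesh 0.
Proof.
apply is_lim_seq_le_le with (fun _ => 0) (fun k => / (INR k + 1)).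
- intros k; split; [left; apply euler_mesh_pos|].
  unfold euler_mesh; pose proof (pos_INR k).
  pose proof (rhs_energy_bound_ge0 k); apply Rinv_le_contravar; nra.
- apply is_lim_seq_const.
- apply is_lim_seq_inv_INR_succ.
Qed.

Lemma euler_mesh_energy_le (k j : nat) :
  INR j * euler_mesh k <= INR k + 1 ->
  euler_energy k (euler_mesh k) j
  <= l + INR j * euler_mesh k * / (INR k + 1) /\
  INR j * euler_mesh k * / (INR k + 1) <= 1.
Proof.
intros Hj; pose proof (pos_INR k) as Hk; pose proof (euler_mesh_pos k) as Hh.
assert (Hs : 0 <= INR j * euler_mesh k)
  by (apply Rmult_le_pos; [apply pos_INR|lra]).
pose proof (euler_mesh_error k _ Hs) as Herr.
assert (H1 : INR j * euler_mesh k * / (INR k + 1) <= 1).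
{ apply Rmult_le_reg_r with (INR k + 1); [lra|].
  rewrite Rmult_assoc, Rinv_l by lra; lra. }
split; [|exact H1].
replace (INR j * euler_mesh k * (euler_mesh k * rhs_energy_bound k))
  with (INR j * (euler_mesh k * euler_mesh k * rhs_energy_bound k)) in Herr
  by ring.
eapply Rle_trans; [apply euler_energy_le; lra|lra].
Qed.

Lemma euler_mesh_bounded (k j m : nat) :
  INR j * euler_mesh k <= INR k + 1 ->
  Rabs (euler k (euler_mesh k) j m) <= l + 1.
Proof.
intros Hj; destruct (euler_mesh_energy_le k j Hj) as [H1 H2].
apply euler_bounded_of_energy; [left; apply euler_mesh_pos|lra].
Qed.

Lemma euler_mesh_lipschitz (k j i n : nat) :
  INR (j + i) * euler_mesh k <= INR k + 1 ->
  Rabs (euler k (euler_mesh k) (j + i) n - euler k (euler_mesh k) j n)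
  <= rhs_bound n * (INR i * euler_mesh k).
Proof.
intros Hji; pose proof (euler_mesh_pos k) as Hh.
destruct (le_lt_dec 1 n) as [H1|H1];
  [destruct (le_lt_dec n k) as [H2|H2]|];
  try (rewrite !euler_out, Rminus_diag, Rabs_R0 by lia;
       apply Rmult_le_pos; [apply rhs_bound_ge0|];
       apply Rmult_le_pos; [apply pos_INR|lra]).
apply (euler_increment (euler_mesh k) (rhs_bound n)
  (fun j => euler k (euler_mesh k) j n)
  (fun j => dyadic_rhs p q (euler k (euler_mesh k) j) n)); [lra| |].
- intros; now apply euler_step.
- intros i' Hi'; apply dyadic_rhs_bounded; intros m; apply euler_mesh_bounded.
  eapply Rle_trans; [|exact Hji].
  apply Rmult_le_compat_r; [lra|apply le_INR; lia].
Qed.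

Lemma Rabs_mult_diff_le (x y x' y' B C c d : R) :
  Rabs x <= B -> Rabs y' <= C -> Rabs (x' - x) <= c -> Rabs (y' - y) <= d ->
  Rabs (x' * y' - x * y) <= C * c + B * d.
Proof.
intros Hx Hy Hc Hd.
replace (x' * y' - x * y) with ((x' - x) * y' + x * (y' - y)) by ring.
eapply Rle_trans; [apply Rabs_triang|]; rewrite !Rabs_mult.
rewrite (Rmult_comm C).
apply Rplus_le_compat; apply Rmult_le_compat; try apply Rabs_pos; assumption.
Qed.

(** A Lipschitz constant in time, along the scheme. It involves only the neighbours of mode [n],
    hence does not depend on the truncation level. *)
Definition rhs_lipschitz (n : nat) : R :=
  p n * rhs_bound n + 2 * (q n * (l + 1) * rhs_bound (n - 1))
  + q (n + 1)%nat * ((l + 1) * (rhs_bound n + rhs_bound (n + 1))).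

Lemma rhs_lipschitz_ge0 (n : nat) : 0 <= rhs_lipschitz n.
Proof.
pose proof l_ge0; pose proof (p_ge0 n).
pose proof (q_ge0 n); pose proof (q_ge0 (n + 1)).
pose proof (rhs_bound_ge0 n); pose proof (rhs_bound_ge0 (n - 1)).
pose proof (rhs_bound_ge0 (n + 1)).
unfold rhs_lipschitz; repeat apply Rplus_le_le_0_compat;
  repeat apply Rmult_le_pos; lra.
Qed.

Lemma euler_mesh_rhs_lipschitz (k j i n : nat) :
  INR (j + i) * euler_mesh k <= INR k + 1 ->
  Rabs (dyadic_rhs p q (euler k (euler_mesh k) (j + i)) n
        - dyadic_rhs p q (euler k (euler_mesh k) j) n)
  <= rhs_lipschitz n * (INR i * euler_mesh k).
Proof.
intros Hji; pose proof (euler_mesh_pos k) as Hh.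
assert (Hj : INR j * euler_mesh k <= INR k + 1).
{ eapply Rle_trans; [|exact Hji].
  apply Rmult_le_compat_r; [lra|apply le_INR; lia]. }
pose proof (fun m => euler_mesh_bounded k j m Hj) as Bx.
pose proof (fun m => euler_mesh_bounded k (j + i) m Hji) as By.
pose proof (fun m => euler_mesh_lipschitz k j i m Hji) as Lip.
set (x := euler k (euler_mesh k) j) in *.
set (y := euler k (euler_mesh k) (j + i)) in *.
set (s := INR i * euler_mesh k) in *.
unfold dyadic_rhs, rhs_lipschitz.
replace (- p n * y n + q n * y (n - 1)%nat ^ 2
    - q (n + 1)%nat * y n * y (n + 1)%nat
    - (- p n * x n + q n * x (n - 1)%nat ^ 2
    - q (n + 1)%nat * x n * x (n + 1)%nat))
  with (- (p n * (y n - x n))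
    + q n * (y (n - 1)%nat * y (n - 1)%nat - x (n - 1)%nat * x (n - 1)%nat)
    + - (q (n + 1)%nat * (y n * y (n + 1)%nat - x n * x (n + 1)%nat))) by ring.
eapply Rle_trans; [apply Rabs_triang|]; rewrite Rmult_plus_distr_r.
apply Rplus_le_compat.
- eapply Rle_trans; [apply Rabs_triang|]; rewrite Rmult_plus_distr_r.
  apply Rplus_le_compat.
  + rewrite Rabs_Ropp, Rabs_mult, (Rabs_pos_eq (p n)), Rmult_assoc
      by apply p_ge0.
    apply Rmult_le_compat_l; [apply p_ge0|apply Lip].
  + rewrite Rabs_mult, (Rabs_pos_eq (q n)) by apply q_ge0.
    replace (2 * (q n * (l + 1) * rhs_bound (n - 1)) * s)
      with (q n * ((l + 1) * (rhs_bound (n - 1) * s)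
                   + (l + 1) * (rhs_bound (n - 1) * s))) by ring.
    apply Rmult_le_compat_l; [apply q_ge0|].
    now apply Rabs_mult_diff_le.
- rewrite Rabs_Ropp, Rabs_mult, (Rabs_pos_eq (q _)) by apply q_ge0.
  replace (q (n + 1)%nat * ((l + 1) * (rhs_bound n + rhs_bound (n + 1))) * s)
    with (q (n + 1)%nat * ((l + 1) * (rhs_bound n * s)
                 + (l + 1) * (rhs_bound (n + 1) * s))) by ring.
  apply Rmult_le_compat_l; [apply q_ge0|].
  now apply Rabs_mult_diff_le.
Qed.

Lemma euler_mesh_dissipation_lipschitz (k j i n : nat) :
  INR (j + i) * euler_mesh k <= INR k + 1 ->
  Rabs (p n * euler k (euler_mesh k) (j + i) n ^ 2
        - p n * euler k (euler_mesh k) j n ^ 2)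
  <= 2 * (p n * (l + 1) * rhs_bound n) * (INR i * euler_mesh k).
Proof.
intros Hji; pose proof (euler_mesh_pos k) as Hh.
assert (Hj : INR j * euler_mesh k <= INR k + 1).
{ eapply Rle_trans; [|exact Hji].
  apply Rmult_le_compat_r; [lra|apply le_INR; lia]. }
pose proof (euler_mesh_bounded k j n Hj) as Bx.
pose proof (euler_mesh_bounded k (j + i) n Hji) as By.
pose proof (euler_mesh_lipschitz k j i n Hji) as Lip.
rewrite <- Rmult_minus_distr_l, Rabs_mult, (Rabs_pos_eq (p n)) by apply p_ge0.
set (s := INR i * euler_mesh k) in *.
replace (2 * (p n * (l + 1) * rhs_bound n) * s)
  with (p n * ((l + 1) * (rhs_bound n * s) + (l + 1) * (rhs_bound n * s)))
  by ring.
apply Rmult_le_compat_l; [apply p_ge0|].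
simpl; rewrite !Rmult_1_r; now apply Rabs_mult_diff_le.
Qed.

End Galerkin.

(** * Calculus on the half-line and existence *)

Lemma derivative_ge0_le (f df : R -> R) (s t : R) :
  s <= t -> (forall x, continuous f x) ->
  (forall x, s < x < t -> is_derive f x (df x)) ->
  (forall x, s < x < t -> 0 <= df x) -> f s <= f t.
Proof.
intros Hst Hc Hd Hpos.
(* The mean value point may be an endpoint, where nothing is known about [df]; the maximum with 0
   covers that case. *)
destruct (MVT_gen f s t (fun x => Rmax 0 (df x))) as [c [_ Hc2]].
- rewrite Rmin_left, Rmax_right by exact Hst; intros x Hx.
  rewrite Rmax_right by now apply Hpos.
  now apply Hd.
- intros x _; apply continuity_pt_filterlim; apply Hc.
- pose proof (Rmax_l 0 (df c)); nra.
Qed.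

(* No derivative is required at 0, where the extension [u (Rmax 0 x)] of a
   function on the half-line has a kink. *)
Definition antideriv (F f : R -> R) : Prop :=
  (forall x, continuous F x) /\ (forall x, 0 < x -> is_derive F x (f x)).

(** Plays the part of monotonicity of the integral in all the time estimates below, with no
    integrability conditions to check. *)
Lemma antideriv_le (F f G g : R -> R) (s t : R) :
  antideriv F f -> antideriv G g -> 0 <= s <= t ->
  (forall x, s < x < t -> f x <= g x) -> F t - F s <= G t - G s.
Proof.
intros [HF1 HF2] [HG1 HG2] Hst H.
assert (G s - F s <= G t - F t); [|lra].
apply (derivative_ge0_le (fun x => G x - F x) (fun x => g x - f x)); [lra| | |].
- intros x; apply (continuous_minus (V := R_NormedModule)); auto.
- intros x Hx; apply (is_derive_minus (V := R_NormedModule));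
    [apply HG2|apply HF2]; lra.
- intros x Hx; specialize (H x Hx); lra.
Qed.

Lemma antideriv_plus (F f G g : R -> R) :
  antideriv F f -> antideriv G g ->
  antideriv (fun x => F x + G x) (fun x => f x + g x).
Proof.
intros [HF1 HF2] [HG1 HG2]; split; intros x.
- apply (continuous_plus (V := R_NormedModule)); auto.
- intros Hx; apply (is_derive_plus (V := R_NormedModule)); auto.
Qed.

Lemma antideriv_scal (F f : R -> R) (c : R) :
  antideriv F f -> antideriv (fun x => c * F x) (fun x => c * f x).
Proof.
intros [HF1 HF2]; split; intros x.
- apply (continuous_scal_r (V := R_NormedModule)); auto.
- intros Hx; apply (is_derive_scal F x c); auto.
Qed.

Lemma antideriv_mult (F f G g : R -> R) :
  antideriv F f -> antideriv G g ->
  antideriv (fun x => F x * G x) (fun x => f x * G x + F x * g x).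
Proof.
intros [HF1 HF2] [HG1 HG2]; split; intros x.
- apply (continuous_mult (K := R_AbsRing)); auto.
- intros Hx; apply (is_derive_mult F G x); auto.
  intros; apply Rmult_comm.
Qed.

Lemma antideriv_const (c : R) :
  antideriv (fun _ => c) (fun _ => 0).
Proof.
split; intros x; [apply continuous_const|].
intros _; apply (is_derive_const (V := R_NormedModule)).
Qed.

Lemma antideriv_ext (F f G g : R -> R) :
  (forall x, F x = G x) -> (forall x, 0 < x -> f x = g x) ->
  antideriv F f -> antideriv G g.
Proof.
intros HFG Hfg [HF1 HF2]; split; intros x.
- now apply continuous_ext with F.
- intros Hx; apply is_derive_ext with F; [exact HFG|].
  rewrite <- Hfg by exact Hx; auto.
Qed.

Lemma antideriv_sum1 (F f : nat -> R -> R) (N : nat) :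
  (forall n, (1 <= n)%nat -> antideriv (F n) (f n)) ->
  antideriv (fun x => sum1 (fun n => F n x) N)
                 (fun x => sum1 (fun n => f n x) N).
Proof.
intros H; induction N as [|N IH].
- apply antideriv_ext with (fun _ => 0) (fun _ => 0);
    try (intros; now rewrite sum1_0); apply antideriv_const.
- apply antideriv_ext with
    (fun x => sum1 (fun n => F n x) N + F (S N) x)
    (fun x => sum1 (fun n => f n x) N + f (S N) x);
    try (intros; now rewrite sum1_S).
  apply antideriv_plus; [exact IH|apply H; lia].
Qed.

Lemma D_in_halfline_is_derive (f d : R -> R) (t : R) :
  0 < t -> D_in f d halfline t -> is_derive f t (d t).
Proof.
intros Ht HD; apply is_derive_Reals; intros eps Heps.
destruct (HD eps Heps) as [alp [Halp H]].
assert (Hdel : 0 < Rmin alp t) by now apply Rmin_pos.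
exists (mkposreal _ Hdel); simpl; intros h Hh0 Hh.
pose proof (Rmin_l alp t); pose proof (Rmin_r alp t).
specialize (H (t + h)); simpl in H; unfold Rdist, D_x, halfline in H.
replace (t + h - t) with h in H by ring.
apply H; apply Rabs_def2 in Hh as Hh'.
repeat split; lra.
Qed.

(** Freezing [f] at its value at 0 for negative times turns one-sided continuity at 0 into ordinary
    continuity, because [Rmax 0] does not increase distances. *)
Lemma D_in_halfline_continuous (f d : R -> R) :
  (forall t, 0 <= t -> D_in f d halfline t) ->
  forall t, continuous (fun x => f (Rmax 0 x)) t.
Proof.
intros HD t; apply continuity_pt_filterlim.
assert (Ht : 0 <= Rmax 0 t) by apply Rmax_l.
intros eps Heps.
destruct (cont_deriv _ _ _ _ (HD _ Ht) eps Heps) as [alp [Halp H]].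
exists alp; split; [exact Halp|].
intros x [_ Hx]; simpl in *; unfold Rdist in *.
destruct (Req_dec (Rmax 0 x) (Rmax 0 t)) as [->|Hne];
  [rewrite Rminus_diag, Rabs_R0; exact Heps|].
apply H; split; [split; [apply Rmax_l|now apply not_eq_sym]|].
apply Rabs_def2 in Hx.
apply Rabs_def1; unfold Rmax; destruct (Rle_dec 0 x), (Rle_dec 0 t); lra.
Qed.

Lemma is_derive_Rmax_ext (f : R -> R) (t l : R) :
  0 < t -> is_derive f t l -> is_derive (fun x => f (Rmax 0 x)) t l.
Proof.
intros Ht; apply is_derive_ext_loc.
exists (mkposreal t Ht); intros x Hx.
apply Rabs_def2 in Hx; simpl in Hx; unfold minus, plus, opp in Hx; simpl in Hx.
now rewrite Rmax_right by lra.
Qed.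

Lemma antideriv_RInt (g : R -> R) :
  (forall x, continuous g x) -> antideriv (fun x => RInt g 0 x) g.
Proof.
intros Hg.
assert (Hd : forall x, is_derive (fun x => RInt g 0 x) x (g x)).
{ intros x; apply (is_derive_RInt g (fun x => RInt g 0 x) 0); [|apply Hg].
  exists (mkposreal 1 Rlt_0_1); intros y _.
  apply (RInt_correct (V := R_CompleteNormedModule)).
  apply (ex_RInt_continuous (V := R_CompleteNormedModule)); intros; apply Hg. }
split; intros x; [|intros _; apply Hd].
apply (ex_derive_continuous (fun x => RInt g 0 x) x); now exists (g x).
Qed.

Lemma RInt_0_0 (g : R -> R) : RInt g 0 0 = 0.
Proof. exact (RInt_point 0 g). Qed.

Lemma antideriv_halfline (f g : R -> R) :
  (forall t, 0 <= t -> D_in f g halfline t) ->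
  antideriv (fun x => f (Rmax 0 x)) (fun x => g (Rmax 0 x)).
Proof.
intros HD; split; [now apply D_in_halfline_continuous with g|].
intros x Hx; rewrite (Rmax_right 0 x) by lra.
apply is_derive_Rmax_ext; [exact Hx|].
apply D_in_halfline_is_derive; [exact Hx|apply HD; lra].
Qed.

Lemma RInt_Rmax_ext (g : R -> R) (t : R) :
  0 <= t -> RInt (fun x => g (Rmax 0 x)) 0 t = RInt g 0 t.
Proof.
intros Ht; apply RInt_ext; intros x; rewrite Rmin_left by exact Ht.
intros [Hx _]; now rewrite Rmax_right by lra.
Qed.

Lemma RInt_halfline_derivative (f g : R -> R) :
  (forall t, 0 <= t -> D_in f g halfline t) ->
  (forall t, continuous (fun x => g (Rmax 0 x)) t) ->
  forall t, 0 <= t -> RInt g 0 t = f t - f 0.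
Proof.
intros HD Hg t Ht.
pose proof (antideriv_halfline f g HD) as HF.
pose proof (antideriv_RInt _ Hg) as HG.
pose proof (antideriv_le _ _ _ _ 0 t HF HG ltac:(lra)
  ltac:(intros; apply Rle_refl)) as H1.
pose proof (antideriv_le _ _ _ _ 0 t HG HF ltac:(lra)
  ltac:(intros; apply Rle_refl)) as H2.
cbv beta in H1, H2.
rewrite RInt_0_0, RInt_Rmax_ext, !Rmax_right in H1, H2 by lra.
lra.
Qed.

(** * Existence by passage to the limit in the Euler schemes *)

Lemma utends_dyadic_rhs (U : (nat -> Prop) -> Prop) {HU : ProperFilter U}
    (p q : nat -> R) (x : nat -> nat -> R) (y : nat -> R) (n : nat) :
  (forall m, utends U (fun k => x k m) (y m)) ->
  utends U (fun k => dyadic_rhs p q (x k) n) (dyadic_rhs p q y n).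
Proof.
intros Hx; unfold dyadic_rhs.
apply (utends_minus U); [apply (utends_plus U)|]; apply (utends_mult U);
  try apply (utends_const U); try apply Hx.
- apply (utends_pow U), Hx.
- apply (utends_mult U); [apply (utends_const U)|apply Hx].
Qed.

Theorem dyadic_existence (p q a : nat -> R) (l : R) :
  (forall n, 0 <= p n) -> (forall n, 0 <= q n) ->
  (forall N, sum1 (fun n => a n ^ 2) N <= l) ->
  exists u : nat -> R -> R,
    (forall t, u 0%nat t = 0) /\
    (forall n, (1 <= n)%nat -> u n 0 = a n) /\
    (forall n t, (1 <= n)%nat -> 0 <= t ->
       D_in (u n) (fun t => dyadic_rhs p q (fun m => u m t) n) halfline t) /\
    (forall N t, 0 <= t ->
       sum1 (fun n =>
         u n t ^ 2 + 2 * RInt (fun s => p n * u n s ^ 2) 0 t) N <= l).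
Proof.
intros Hp Hq Ha.
destruct exists_free_ultrafilter as [U [HU [HUf HUu]]].
pose (h := euler_mesh p q l).
pose (x := fun k t => euler p q a k (h k) (grid_index (h k) t)).
pose (g := fun k t => euler_dissipation p q a k (h k) (grid_index (h k) t)).
assert (Hh : forall k, 0 < h k) by now apply (euler_mesh_pos p q l).
(* For [U]-most [k], the first [K] modes are active and the node before [t] lies within the horizon
   of the mesh estimates. *)
assert (Hev : forall t (K : nat), 0 <= t -> U (fun k => (K <= k)%nat /\
   INR (grid_index (h k) t) * h k <= t /\
   INR (grid_index (h k) t) * h k <= INR k + 1)).
{ intros t K Ht; destruct (nfloor_ex t Ht) as [n Hn].
  eapply filter_imp; [|exact (U_large U HUf (Nat.max K n))].
  intros k Hk; simpl in Hk; split; [lia|].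
  pose proof (grid_index_bounds (h k) t (Hh k) Ht).
  assert (INR n <= INR k) by (apply le_INR; lia); lra. }
pose (u := fun n t => ulim U (fun k => x k t n)).
pose (G := fun n t => ulim U (fun k => g k t n)).
assert (Hu : forall n t, 0 <= t -> utends U (fun k => x k t n) (u n t)).
{ intros n t Ht; apply (ulim_spec U HUu _ (l + 1)).
  eapply filter_imp; [|exact (Hev t 0%nat Ht)]; intros k [_ [_ Hk]].
  now apply euler_mesh_bounded. }
assert (HG : forall n t, (1 <= n)%nat -> 0 <= t ->
  utends U (fun k => g k t n) (G n t)).
{ intros n t Hn Ht; apply (ulim_spec U HUu _ (l + 1)).
  eapply filter_imp; [|exact (Hev t n Ht)]; intros k [Hkn [_ Hk]].
  destruct (euler_mesh_energy_le p q a l Hp Hq Ha k _ Hk) as [E1 E2].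
  fold (h k) in E1, E2; unfold euler_energy in E1.
  pose proof (euler_dissipation_ge0 p q a Hp k (h k) (grid_index (h k) t) n
    (Rlt_le _ _ (Hh k))) as Hpos.
  unfold g; rewrite Rabs_pos_eq by exact Hpos.
  eapply Rle_trans;
    [|eapply Rle_trans; [apply (sum1_term_le (fun n =>
        euler p q a k (h k) (grid_index (h k) t) n ^ 2
        + 2 * euler_dissipation p q a k (h k) (grid_index (h k) t) n) n k)|]].
  - simpl; pose proof (pow2_ge_0 (euler p q a k (h k) (grid_index (h k) t) n)).
    lra.
  - intros m _.
    pose proof (pow2_ge_0 (euler p q a k (h k) (grid_index (h k) t) m)).
    pose proof (euler_dissipation_ge0 p q a Hp k (h k) (grid_index (h k) t) m
      (Rlt_le _ _ (Hh k))); lra.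
  - lia.
  - lra. }
assert (Hmesh0 : is_lim_seq h 0) by now apply (euler_mesh_lim p q l).
assert (Hlim_eq : forall (s : nat -> R) (v w : R),
  utends U s v -> U (fun k => s k = w) -> v = w).
{ intros s v w Hs Hw; apply Rle_antisym.
  - apply (utends_le U s (fun _ => w)); [exact Hs|apply (utends_const U)|].
    revert Hw; apply filter_imp; intros; lra.
  - apply (utends_le U (fun _ => w) s); [apply (utends_const U)|exact Hs|].
    revert Hw; apply filter_imp; intros; lra. }
assert (HuD : forall n t, (1 <= n)%nat -> 0 <= t ->
  D_in (u n) (fun t => dyadic_rhs p q (fun m => u m t) n) halfline t).
{ intros n t Hn Ht.
  apply (euler_limit_D_in U HUf h
    (fun k j => euler p q a k (h k) j n)
    (fun k j => dyadic_rhs p q (euler p q a k (h k) j) n)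
    _ _ (rhs_bound p q l n) (rhs_lipschitz p q l n) n);
    try assumption; [now apply (rhs_lipschitz_ge0 p q a)| | |].
  - intros k Hk; split; [|split].
    + intros j; apply euler_step; lia.
    + intros j Hj; apply (dyadic_rhs_bounded p q a); try assumption.
      intros m; now apply euler_mesh_bounded.
    + intros j i Hji; now apply euler_mesh_rhs_lipschitz.
  - intros s Hs; now apply Hu.
  - intros s Hs; apply (utends_dyadic_rhs U); intros m; now apply Hu. }
assert (HGD : forall n t, (1 <= n)%nat -> 0 <= t ->
  D_in (G n) (fun t => p n * u n t ^ 2) halfline t).
{ intros n t Hn Ht.
  apply (euler_limit_D_in U HUf h
    (fun k j => euler_dissipation p q a k (h k) j n)
    (fun k j => p n * euler p q a k (h k) j n ^ 2)
    _ _ (p n * (l + 1) ^ 2) (2 * (p n * (l + 1) * rhs_bound p q l n)) n);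
    try assumption.
  - pose proof (l_ge0 a l Ha); pose proof (rhs_bound_ge0 p q a l Hp Hq Ha n).
    repeat apply Rmult_le_pos; try apply Hp; lra.
  - intros k Hk; split; [|split].
    + intros j; reflexivity.
    + intros j Hj.
      rewrite Rabs_mult, (Rabs_pos_eq (p n)), <- RPow_abs by apply Hp.
      apply Rmult_le_compat_l; [apply Hp|]; apply pow_incr.
      split; [apply Rabs_pos|now apply euler_mesh_bounded].
    + intros j i Hji; now apply euler_mesh_dissipation_lipschitz.
  - intros s Hs; now apply HG.
  - intros s Hs; apply (utends_mult U); [apply (utends_const U)|].
    now apply (utends_pow U), Hu. }
(* [G n] vanishes at 0 and has the continuous derivative [p n * u n t ^ 2], so it is the dissipation
   integral of the limit. *)
assert (HGint : forall n t, (1 <= n)%nat -> 0 <= t ->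
  RInt (fun s => p n * u n s ^ 2) 0 t = G n t).
{ intros n t Hn Ht.
  assert (HG0 : G n 0 = 0).
  { apply (Hlim_eq (fun k => g k 0 n)); [exact (HG n 0 Hn (Rle_refl 0))|].
    apply filter_forall; intros k; unfold g; now rewrite grid_index_0. }
  transitivity (G n t - G n 0); [|lra].
  apply RInt_halfline_derivative; [| |exact Ht].
  - intros; now apply HGD.
  - intros s.
    apply (continuous_mult (K := R_AbsRing) (fun _ : R => p n)
      (fun s => u n (Rmax 0 s) ^ 2)); [apply continuous_const|].
    apply (continuous_comp (fun s => u n (Rmax 0 s)) (fun y => y ^ 2)).
    + eapply (D_in_halfline_continuous (u n)); intros; now apply HuD.
    + apply (ex_derive_continuous (fun y : R => y ^ 2)); auto_derive; trivial. }
exists u; split; [|split; [|split; [exact HuD|]]].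
- intros t; apply (Hlim_eq (fun k => x k t 0%nat)).
  + apply (ulim_spec U HUu _ 0); apply filter_forall; intros k.
    unfold x; rewrite euler_out, Rabs_R0 by lia; lra.
  + apply filter_forall; intros k; apply euler_out; lia.
- intros n Hn; apply (Hlim_eq (fun k => x k 0 n)); [apply Hu; lra|].
  eapply filter_imp; [|exact (U_large U HUf n)]; intros k Hk; simpl in Hk.
  unfold x; rewrite grid_index_0 by apply Hh; apply euler_init; lia.
(* For [k >= N] the first [N] modes carry no more energy than all [k] of them, and the latter
   exceeds [l] by at most [t / (k + 1)], which vanishes in the limit. *)
- intros N t Ht; replace l with (l + t * 0) by ring.
  apply (utends_le U (fun k => sum1 (fun n => x k t n ^ 2 + 2 * g k t n) N)
                     (fun k => l + t * / (INR k + 1))).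
  + apply (utends_sum1 U (fun k n => x k t n ^ 2 + 2 * g k t n)); intros n Hn.
    rewrite HGint by (lia || lra).
    apply (utends_plus U); [apply (utends_pow U); now apply Hu|].
    apply (utends_mult U); [apply (utends_const U)|apply HG; [lia|exact Ht]].
  + apply (utends_plus U); [apply (utends_const U)|].
    apply (utends_mult U); [apply (utends_const U)|].
    apply (utends_is_lim_seq U HUf), is_lim_seq_inv_INR_succ.
  + eapply filter_imp; [|exact (Hev t N Ht)]; intros k [HkN [Hjt Hk]].
    destruct (euler_mesh_energy_le p q a l Hp Hq Ha k _ Hk) as [E1 _].
    fold (h k) in E1; unfold euler_energy in E1.
    eapply Rle_trans; [apply sum1_mono; [|exact HkN]|].
    * intros m _; unfold x, g.
      pose proof (pow2_ge_0 (euler p q a k (h k) (grid_index (h k) t) m)).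
      pose proof (euler_dissipation_ge0 p q a Hp k (h k) (grid_index (h k) t) m
        (Rlt_le _ _ (Hh k))); lra.
    * eapply Rle_trans; [exact E1|].
      apply Rplus_le_compat_l, Rmult_le_compat_r; [|exact Hjt].
      left; apply Rinv_0_lt_compat; pose proof (pos_INR k); lra.
Qed.

(** * A priori bounds and uniqueness *)

Lemma dyadic_rhs_S (p q x : nat -> R) (n : nat) :
  dyadic_rhs p q x (S n) =
  - p (S n) * x (S n) + q (S n) * x n ^ 2 - q (S (S n)) * x (S n) * x (S (S n)).
Proof.
unfold dyadic_rhs; replace (S n - 1)%nat with n by lia.
now replace (S n + 1)%nat with (S (S n)) by lia.
Qed.

(* Formal polynomials in the modes are closed under the time derivative, which
   yields derivatives of all orders at once. *)
Inductive mode_polynomial : Type :=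
  | Mode (n : nat)
  | Const (c : R)
  | Sum (f g : mode_polynomial)
  | Prod (f g : mode_polynomial).

Fixpoint mode_eval (x : nat -> R) (f : mode_polynomial) : R :=
  match f with
  | Mode n => x n
  | Const c => c
  | Sum f g => mode_eval x f + mode_eval x g
  | Prod f g => mode_eval x f * mode_eval x g
  end.

Fixpoint mode_derivative (p q : nat -> R) (f : mode_polynomial)
  : mode_polynomial :=
  match f with
  | Mode O => Const 0
  | Mode (S n) =>
      Sum (Sum (Prod (Const (- p (S n))) (Mode (S n)))
               (Prod (Const (q (S n))) (Prod (Mode n) (Mode n))))
          (Prod (Const (- q (S (S n)))) (Prod (Mode (S n)) (Mode (S (S n)))))
  | Const _ => Const 0
  | Sum f g => Sum (mode_derivative p q f) (mode_derivative p q g)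
  | Prod f g => Sum (Prod (mode_derivative p q f) g)
                    (Prod f (mode_derivative p q g))
  end.

Lemma D_in_eq (f d d' : R -> R) (D : R -> Prop) (t : R) :
  d t = d' t -> D_in f d D t -> D_in f d' D t.
Proof. unfold D_in; now intros ->. Qed.

Lemma smooth_halfline_of_dyadic (p q : nat -> R) (u : nat -> R -> R) (n : nat) :
  (forall t, u 0%nat t = 0) ->
  (forall n t, (1 <= n)%nat -> 0 <= t ->
     D_in (u n) (fun t => dyadic_rhs p q (fun m => u m t) n) halfline t) ->
  smooth_halfline (u n).
Proof.
intros H0 HD.
pose (ev := fun f t => mode_eval (fun m => u m t) f).
assert (Hev : forall f t, 0 <= t ->
  D_in (ev f) (ev (mode_derivative p q f)) halfline t).
{ intros f t Ht; induction f as [[|m]|c|f IHf g IHg|f IHf g IHg]; simpl.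
  - intros eps Heps; exists 1; split; [lra|]; intros x [[_ Hx] _].
    unfold ev; simpl; rewrite !H0; unfold Rdist.
    replace ((0 - 0) / (x - t) - 0) with 0 by (field; lra).
    now rewrite Rabs_R0.
  - eapply D_in_eq; [|exact (HD (S m) t ltac:(lia) Ht)].
    unfold ev; simpl; rewrite dyadic_rhs_S; ring.
  - exact (Dconst halfline c t).
  - exact (Dadd halfline _ _ _ _ t IHf IHg).
  - exact (Dmult halfline _ _ _ _ t IHf IHg). }
exists (fun k => ev (Nat.iter k (mode_derivative p q) (Mode n))); split.
- reflexivity.
- intros k t Ht; now apply Hev.
Qed.

(** A Leray-Hopf solution composed with [Rmax 0] has this form: continuous on the whole line,
    differentiable at positive times, with the energy inequality read on partial sums. *)
Definition energy_curve (p q a : nat -> R) (l : R) (u : nat -> R -> R) : Prop :=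
  (forall n t, continuous (u n) t) /\
  (forall t, u 0%nat t = 0) /\
  (forall n, (1 <= n)%nat -> u n 0 = a n) /\
  (forall n t, (1 <= n)%nat -> 0 < t ->
     is_derive (u n) t (dyadic_rhs p q (fun m => u m t) n)) /\
  (forall N t, 0 <= t ->
     sum1 (fun n =>
       u n t ^ 2 + 2 * RInt (fun s => p n * u n s ^ 2) 0 t) N <= l).

(* The constant [/ (4 L ^ 2)] beats the growth of the crude bound [M * q n]:
   after [k] iterations only [2 ^ (- k) * M * q n] of it is left. *)
Lemma backward_recursion_bound (b q : nat -> R) (M L C : R) :
  1 <= L -> 0 <= C -> 0 <= M -> (forall n, 0 <= q n) ->
  (forall n, q (S n) = L * q n) ->
  (forall n, (1 <= n)%nat -> b n <= M * q n) ->
  (forall n, (1 <= n)%nat ->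
     b n <= C + / (4 * L ^ 2) * (b (S n) + b (S (S n)))) ->
  forall n, (1 <= n)%nat -> b n <= 2 * C.
Proof.
intros HL HC HM Hq Hgrow Hb Hrec.
assert (Hk : forall k n, (1 <= n)%nat -> b n <= 2 * C + (/ 2) ^ k * (M * q n)).
{ induction k as [|k IH]; intros n Hn.
  - simpl; specialize (Hb n Hn); lra.
  - eapply Rle_trans; [now apply Hrec|].
    pose proof (IH (S n) ltac:(lia)) as H1.
    pose proof (IH (S (S n)) ltac:(lia)) as H2.
    rewrite !Hgrow in H2; rewrite Hgrow in H1; simpl pow.
    rewrite Rmult_1_r.
    set (z := (/ 2) ^ k) in *.
    assert (Hz : 0 <= z * (M * q n)).
    { apply Rmult_le_pos; [apply pow_le; lra|now apply Rmult_le_pos]. }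
    apply Rmult_le_reg_l with (4 * (L * L)); [nra|].
    replace (4 * (L * L) * (C + / (4 * (L * L)) * (b (S n) + b (S (S n)))))
      with (4 * (L * L) * C + (b (S n) + b (S (S n)))) by (field; nra).
    assert (b (S n) + b (S (S n))
            <= 4 * C + (L + L * L) * (z * (M * q n))) by nra.
    assert ((L + L * L) * (z * (M * q n)) <= (2 * (L * L)) * (z * (M * q n)))
      by (apply Rmult_le_compat_r; nra).
    assert (1 * C <= L * L * C) by (apply Rmult_le_compat_r; nra).
    lra. }
intros n Hn.
apply (is_lim_seq_le (fun _ => b n) (fun k => 2 * C + (/ 2) ^ k * (M * q n))
  (Finite (b n)) (Finite (2 * C))).
- intros k; now apply Hk.
- apply is_lim_seq_const.
- replace (Finite (2 * C)) with (Finite (2 * C + 0 * (M * q n)))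
    by (f_equal; ring).
  apply is_lim_seq_plus'; [apply is_lim_seq_const|].
  apply is_lim_seq_mult'; [|apply is_lim_seq_const].
  apply is_lim_seq_geom; rewrite Rabs_pos_eq; lra.
Qed.

Lemma Rabs_le_add_twice (x c : R) : 0 <= c -> - c <= x -> Rabs x <= x + 2 * c.
Proof. intros; apply Rabs_le; lra. Qed.

(** This is x y <= k x^2 + d y^2, valid since 4 d k >= 1, multiplied by y. It trades a mixed term
    for a flux term with a large factor and a cube with a small one. *)
Lemma young_2 (x y d k : R) :
  0 <= y -> 0 <= x -> 0 <= d -> 0 <= k -> 1 <= 4 * d * k ->
  x * y ^ 2 <= k * (x ^ 2 * y) + d * y ^ 3.
Proof.
intros Hy Hx Hd Hk Hdk.
assert (x * y <= k * x ^ 2 + d * y ^ 2); [|simpl in *; nra].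
destruct (Req_dec k 0) as [->|Hk0]; [lra|].
apply Rmult_le_reg_l with (4 * k); [lra|].
assert (y ^ 2 <= 4 * d * k * y ^ 2) by (pose proof (pow2_ge_0 y); nra).
pose proof (pow2_ge_0 (2 * k * x - y)); simpl in *; nra.
Qed.

Lemma sqr_mult_le_cubes (x z : R) :
  0 <= x -> 0 <= z -> x ^ 2 * z <= x ^ 3 + z ^ 3.
Proof.
intros Hx Hz; destruct (Rle_lt_dec z x) as [Hle|Hlt].
- assert (0 <= z ^ 3) by now apply pow_le.
  assert (x ^ 2 * z <= x ^ 2 * x)
    by (apply Rmult_le_compat_l; [apply pow2_ge_0|exact Hle]).
  simpl in *; lra.
- assert (0 <= x ^ 3) by now apply pow_le.
  assert (x ^ 2 * z <= z ^ 2 * z)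
    by (apply Rmult_le_compat_r; [exact Hz|apply pow_incr; lra]).
  simpl in *; lra.
Qed.

Lemma young_3 (x y z d k : R) :
  0 <= x -> 0 <= y -> 0 <= z -> 0 <= d -> 0 <= k -> 1 <= 4 * d * k ->
  x * y * z <= k * (y ^ 2 * z) + d * (x ^ 3 + z ^ 3).
Proof.
intros Hx Hy Hz Hd Hk Hdk.
assert (x * y <= k * y ^ 2 + d * x ^ 2).
{ destruct (Req_dec k 0) as [->|Hk0]; [lra|].
  apply Rmult_le_reg_l with (4 * k); [lra|].
  assert (x ^ 2 <= 4 * d * k * x ^ 2) by (pose proof (pow2_ge_0 x); nra).
  pose proof (pow2_ge_0 (2 * k * y - x)); simpl in *; nra. }
pose proof (sqr_mult_le_cubes x z Hx Hz).
apply Rle_trans with ((k * y ^ 2 + d * x ^ 2) * z);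
  [now apply Rmult_le_compat_r|].
assert (d * (x ^ 2 * z) <= d * (x ^ 3 + z ^ 3))
  by now apply Rmult_le_compat_l.
lra.
Qed.

Lemma continuous_pow (f : R -> R) (m : nat) (t : R) :
  continuous f t -> continuous (fun x => f x ^ m) t.
Proof.
intros Hf; induction m as [|m IH]; simpl; [apply continuous_const|].
now apply (continuous_mult (K := R_AbsRing)).
Qed.

Lemma antideriv_ge0 (F f : R -> R) (t : R) :
  antideriv F f -> F 0 = 0 -> 0 <= t ->
  (forall s, 0 < s -> 0 <= f s) -> 0 <= F t.
Proof.
intros HF H0 Ht Hf.
pose proof (antideriv_le _ _ _ _ 0 t (antideriv_const 0) HF
  ltac:(lra) ltac:(intros; apply Hf; lra)); lra.
Qed.

Section EnergyCurves.

(** [P] and [L] are the ratios lambda^2 and lambda^beta, [l] is the initial energy, and [e n] bounds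
    the root of the energy of the data in the modes >= n. The assumption on the data enters through
    [qe_le]: the coupling times [e n] is dominated by the viscosity. *)
Variables p q a e : nat -> R.
Variables l P L K : R.
Hypothesis P_ge1 : 1 <= P.
Hypothesis L_ge1 : 1 <= L.
Hypothesis K_ge0 : 0 <= K.
Hypothesis p_0 : p 0%nat = 1.
Hypothesis q_0 : q 0%nat = 1.
Hypothesis p_S : forall n, p (S n) = P * p n.
Hypothesis q_S : forall n, q (S n) = L * q n.
Hypothesis e_ge0 : forall n, 0 <= e n.
Hypothesis e_tail : forall n, l - sum1 (fun m => a m ^ 2) n <= e (S n) ^ 2.
Hypothesis qe_le : forall n, q n * e n <= K * p n.

Lemma p_ge1 (n : nat) : 1 <= p n.
Proof. induction n as [|n IH]; [rewrite p_0; lra|rewrite p_S; nra]. Qed.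

Lemma q_ge1 (n : nat) : 1 <= q n.
Proof. induction n as [|n IH]; [rewrite q_0; lra|rewrite q_S; nra]. Qed.

(** * A priori bounds on a single solution *)

Section OneCurve.

Variable u : nat -> R -> R.
Hypothesis Hu : energy_curve p q a l u.

Let u_cont : forall n t, continuous (u n) t := proj1 Hu.
Let u_0 : forall t, u 0%nat t = 0 := proj1 (proj2 Hu).
Let u_init : forall n, (1 <= n)%nat -> u n 0 = a n :=
  proj1 (proj2 (proj2 Hu)).
Let u_energy := proj2 (proj2 (proj2 (proj2 Hu))).

Lemma mode_antideriv (n : nat) :
  (1 <= n)%nat ->
  antideriv (u n) (fun t => dyadic_rhs p q (fun m => u m t) n).
Proof.
intros Hn; split; [apply u_cont|].
intros t Ht; now apply (proj1 (proj2 (proj2 (proj2 Hu)))).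
Qed.

Definition dissipation (n : nat) (t : R) : R :=
  RInt (fun s => p n * u n s ^ 2) 0 t.

Lemma dissipation_antideriv (n : nat) :
  antideriv (dissipation n) (fun t => p n * u n t ^ 2).
Proof.
apply antideriv_RInt; intros t.
apply (continuous_mult (K := R_AbsRing)); [apply continuous_const|].
apply continuous_pow, u_cont.
Qed.

Lemma dissipation_ge0 (n : nat) (t : R) : 0 <= t -> 0 <= dissipation n t.
Proof.
intros Ht; apply (antideriv_ge0 _ _ t (dissipation_antideriv n));
  [apply RInt_0_0|exact Ht|].
intros s _; pose proof (p_ge1 n); pose proof (pow2_ge_0 (u n s)); nra.
Qed.

Lemma mode_energy_le (n : nat) (t : R) :
  0 <= t -> u n t ^ 2 + 2 * dissipation n t <= l.
Proof.
intros Ht; destruct n as [|n].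
- rewrite u_0.
  assert (dissipation 0 t = 0).
  { unfold dissipation; rewrite (RInt_ext _ (fun _ => 0)).
    - rewrite RInt_const; apply Rmult_0_r.
    - intros x _; rewrite u_0, pow_i by lia; apply Rmult_0_r. }
  specialize (u_energy 0 t Ht); rewrite sum1_0 in u_energy; lra.
- eapply Rle_trans; [|exact (u_energy (S n) t Ht)].
  apply (sum1_term_le (fun n =>
    u n t ^ 2 + 2 * RInt (fun s => p n * u n s ^ 2) 0 t)); [|lia].
  intros m _; pose proof (dissipation_ge0 m t Ht) as H; unfold dissipation in H.
  pose proof (pow2_ge_0 (u m t)); lra.
Qed.

Lemma l_nonneg : 0 <= l.
Proof.
specialize (u_energy 0 0 (Rle_refl 0)); now rewrite sum1_0 in u_energy.
Qed.

Lemma mode_bounded (n : nat) (t : R) : 0 <= t -> Rabs (u n t) <= l + 1.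
Proof.
intros Ht; pose proof (mode_energy_le n t Ht); pose proof l_nonneg.
pose proof (dissipation_ge0 n t Ht); apply Rabs_le; split; nra.
Qed.

(** The equation of a mode is linear in that mode with a nonnegative source, u' = - b u + q
    u_prev^2. Multiplied by the integrating factor exp (int b), the mode is nondecreasing. *)
Lemma mode_sign_persists (n : nat) (s t : R) :
  (1 <= n)%nat -> 0 <= s <= t -> 0 <= u n s -> 0 <= u n t.
Proof.
intros Hn Hst Hs; destruct n as [|n]; [lia|].
pose (b := fun x => p (S n) + q (S (S n)) * u (S (S n)) x).
assert (Hb : forall x, continuous b x).
{ intros x; apply (continuous_plus (V := R_NormedModule));
    [apply continuous_const|].
  apply (continuous_mult (K := R_AbsRing)); [apply continuous_const|].
  apply u_cont. }
destruct (antideriv_RInt b Hb) as [HB1 HB2].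
pose (B := fun x => RInt b 0 x).
assert (HE : antideriv (fun x => exp (B x)) (fun x => b x * exp (B x))).
{ split; intros x.
  - apply (continuous_comp B exp); [apply HB1|].
    apply (ex_derive_continuous exp); auto_derive; trivial.
  - intros Hx; apply (is_derive_comp exp B); [apply is_derive_exp|].
    now apply HB2. }
pose proof (antideriv_mult _ _ _ _ (mode_antideriv (S n) Hn) HE) as H.
pose proof (antideriv_le _ _ _ _ s t (antideriv_const 0) H Hst) as H'.
cbv beta in H'.
assert (Hle : u (S n) s * exp (B s) <= u (S n) t * exp (B t)).
{ assert (0 - 0 <= u (S n) t * exp (B t) - u (S n) s * exp (B s)); [|lra].
  apply H'; intros x _; rewrite dyadic_rhs_S; unfold b.
  pose proof (exp_pos (B x)); pose proof (q_ge1 (S n)).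
  apply Rle_trans with (q (S n) * u n x ^ 2 * exp (B x)); [|right; ring].
  apply Rmult_le_pos; [apply Rmult_le_pos; [lra|apply pow2_ge_0]|lra]. }
pose proof (exp_pos (B s)); pose proof (exp_pos (B t)).
apply Rnot_lt_le; intros Hneg; nra.
Qed.

(** The energy equality for the first [N] modes: the dissipation cancels and only the flux to the
    next mode is left. *)
Lemma partial_energy_antideriv (N : nat) :
  antideriv
    (fun t => sum1 (fun n => u n t ^ 2 + 2 * dissipation n t) N)
    (fun t => - 2 * (q (S N) * u N t ^ 2 * u (S N) t)).
Proof.
eapply antideriv_ext; [reflexivity| |
  apply (antideriv_sum1 (fun n t => u n t ^ 2 + 2 * dissipation n t)
    (fun n t => 2 * u n t * dyadic_rhs p q (fun m => u m t) n
                + 2 * (p n * u n t ^ 2)))].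
- intros t _; cbv beta.
  rewrite (sum1_lin _ (fun n => p n * u n t ^ 2)).
  rewrite (energy_flux p q (fun m => u m t)) by apply u_0; ring.
- intros n Hn; apply antideriv_plus;
    [|apply antideriv_scal, dissipation_antideriv].
  eapply antideriv_ext;
    [| |apply antideriv_mult; apply (mode_antideriv n Hn)];
    intros; cbv beta; ring.
Qed.

Lemma partial_energy_init (N : nat) :
  sum1 (fun n => u n 0 ^ 2 + 2 * dissipation n 0) N =
  sum1 (fun n => a n ^ 2) N.
Proof.
apply sum1_ext; intros n Hn; unfold dissipation.
rewrite RInt_0_0, u_init by lia; ring.
Qed.

(* As long as [u n <= 0] the energy flux goes from the modes [>= n] to the lower
   ones, so the Leray-Hopf inequality bounds the energy of the former by its
   initial value. *)
Lemma mode_lower_bound (n : nat) (t : R) : 0 <= t -> - e n <= u n t.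
Proof.
intros Ht; destruct n as [|N]; [rewrite u_0; specialize (e_ge0 0); lra|].
apply Rnot_lt_le; intros Hlt.
(* A positive value at some earlier time would have persisted up to [t]. *)
assert (Hneg : forall s, 0 <= s <= t -> u (S N) s <= 0).
{ intros s Hs; apply Rnot_lt_le; intros Hpos.
  pose proof (mode_sign_persists (S N) s t ltac:(lia) Hs ltac:(lra)).
  specialize (e_ge0 (S N)); lra. }
pose proof (antideriv_le _ _ _ _ 0 t (antideriv_const 0)
  (partial_energy_antideriv N) ltac:(lra)) as Hmon.
cbv beta in Hmon; rewrite partial_energy_init in Hmon.
assert (Hfl : forall s, 0 < s < t ->
  0 <= - 2 * (q (S N) * u N s ^ 2 * u (S N) s)).
{ intros s Hs; specialize (Hneg s ltac:(lra)); pose proof (q_ge1 (S N)).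
  assert (0 <= q (S N) * u N s ^ 2)
    by (apply Rmult_le_pos; [lra|apply pow2_ge_0]); nra. }
specialize (Hmon Hfl).
(* The first [N] modes, with their dissipation, still hold at least their initial energy, so at most
   the initial tail is left for mode [S N]. *)
pose proof (u_energy (S N) t Ht) as HE; rewrite sum1_S in HE.
fold (dissipation (S N) t) in HE.
change (sum1 _ N)
  with (sum1 (fun n => u n t ^ 2 + 2 * dissipation n t) N) in HE.
pose proof (dissipation_ge0 (S N) t Ht); specialize (e_tail N).
specialize (e_ge0 (S N)); nra.
Qed.

Definition flux (n : nat) (t : R) : R :=
  RInt (fun s => q (S n) * u n s ^ 2 * Rabs (u (S n) s)) 0 t.

Definition cubic (n : nat) (t : R) : R :=
  RInt (fun s => q n * Rabs (u n s) ^ 3) 0 t.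

Lemma continuous_Rabs_mode (n : nat) (t : R) :
  continuous (fun s => Rabs (u n s)) t.
Proof.
apply (continuous_comp (u n) Rabs); [apply u_cont|apply continuous_Rabs].
Qed.

Lemma flux_antideriv (n : nat) :
  antideriv (flux n) (fun t => q (S n) * u n t ^ 2 * Rabs (u (S n) t)).
Proof.
apply antideriv_RInt; intros t.
apply (continuous_mult (K := R_AbsRing)); [|apply continuous_Rabs_mode].
apply (continuous_mult (K := R_AbsRing)); [apply continuous_const|].
apply continuous_pow, u_cont.
Qed.

Lemma cubic_antideriv (n : nat) :
  antideriv (cubic n) (fun t => q n * Rabs (u n t) ^ 3).
Proof.
apply antideriv_RInt; intros t.
apply (continuous_mult (K := R_AbsRing)); [apply continuous_const|].
apply continuous_pow, continuous_Rabs_mode.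
Qed.

(** The energy equality bounds the signed flux. Replacing [u (S n)] by its absolute value costs at
    most 2 [e (S n)], and by [qe_le] that is paid for by the dissipation of mode [n]. *)
Lemma flux_bound (n : nat) (t : R) :
  0 <= t -> flux n t <= l + K * P * l.
Proof.
intros Ht.
assert (Hcmp : antideriv
  (fun t => - 2 * flux n t + 4 * K * P * dissipation n t)
  (fun t => - 2 * (q (S n) * u n t ^ 2 * Rabs (u (S n) t))
            + 4 * K * P * (p n * u n t ^ 2))).
{ apply antideriv_plus; apply antideriv_scal;
    [apply flux_antideriv|apply dissipation_antideriv]. }
pose proof (antideriv_le _ _ _ _ 0 t (partial_energy_antideriv n)
  Hcmp ltac:(lra)) as Hle.
cbv beta in Hle; rewrite partial_energy_init in Hle.
unfold flux at 2, dissipation at 3 in Hle; rewrite !RInt_0_0 in Hle.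
assert (Hpt : forall s, 0 < s < t ->
  - 2 * (q (S n) * u n s ^ 2 * u (S n) s) <=
  - 2 * (q (S n) * u n s ^ 2 * Rabs (u (S n) s))
  + 4 * K * P * (p n * u n s ^ 2)).
{ intros s Hs.
  pose proof (Rabs_le_add_twice _ _ (e_ge0 (S n))
    (mode_lower_bound (S n) s ltac:(lra))) as H1.
  specialize (qe_le (S n)) as H2; rewrite p_S in H2.
  pose proof (q_ge1 (S n)); pose proof (pow2_ge_0 (u n s)).
  set (y := u n s ^ 2) in *; set (z := u (S n) s) in *.
  apply (Rmult_le_compat_l (q (S n) * y)) in H1; [|nra].
  apply (Rmult_le_compat_r y) in H2; [|lra].
  lra. }
specialize (Hle Hpt).
assert (H0 : 0 <= sum1 (fun m => u m t ^ 2 + 2 * dissipation m t) n).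
{ apply sum1_ge0; intros m _; pose proof (dissipation_ge0 m t Ht).
  pose proof (pow2_ge_0 (u m t)); lra. }
pose proof (u_energy n 0 (Rle_refl 0)) as Hinit.
change (sum1 _ n) with (sum1 (fun m => u m 0 ^ 2 + 2 * dissipation m 0) n)
  in Hinit; rewrite partial_energy_init in Hinit.
pose proof (mode_energy_le n t Ht); pose proof (pow2_ge_0 (u n t)).
assert (0 <= K * P) by nra.
assert (K * P * (2 * dissipation n t) <= K * P * l)
  by (apply Rmult_le_compat_l; lra).
pose proof l_nonneg; lra.
Qed.

(** One factor is bounded by [l + 1], the other two by the dissipation. The bound grows like [q n];
    it only serves as the starting point of [backward_recursion_bound]. *)
Lemma cubic_growth (n : nat) (t : R) :
  0 <= t -> cubic n t <= (l + 1) * l * q n.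
Proof.
intros Ht.
pose proof (antideriv_le _ _ _ _ 0 t (cubic_antideriv n)
  (antideriv_scal _ _ (q n * (l + 1)) (dissipation_antideriv n))
  ltac:(lra)) as Hle.
cbv beta in Hle; unfold cubic at 2, dissipation at 2 in Hle.
rewrite !RInt_0_0 in Hle.
assert (Hpt : forall s, 0 < s < t ->
  q n * Rabs (u n s) ^ 3 <= q n * (l + 1) * (p n * u n s ^ 2)).
{ intros s Hs; pose proof (mode_bounded n s ltac:(lra)) as Hb.
  rewrite <- (pow2_abs (u n s)).
  pose proof (Rabs_pos (u n s)); set (y := Rabs (u n s)) in *.
  pose proof (p_ge1 n); pose proof (q_ge1 n).
  rewrite Rmult_assoc; apply Rmult_le_compat_l; [lra|].
  assert (y * y ^ 2 <= (l + 1) * (p n * y ^ 2)); [|simpl in *; lra].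
  apply Rmult_le_compat; [lra|apply pow2_ge_0|exact Hb|].
  pose proof (pow2_ge_0 y); nra. }
specialize (Hle Hpt).
pose proof (mode_energy_le n t Ht); pose proof (pow2_ge_0 (u n t)).
pose proof l_nonneg; pose proof (q_ge1 n); pose proof (dissipation_ge0 n t Ht).
assert (q n * (l + 1) * dissipation n t <= q n * (l + 1) * l)
  by (apply Rmult_le_compat_l; nra).
lra.
Qed.

Lemma cubic_ge0 (n : nat) (t : R) : 0 <= t -> 0 <= cubic n t.
Proof.
intros Ht; apply (antideriv_ge0 _ _ t (cubic_antideriv n));
  [apply RInt_0_0|exact Ht|].
intros s _; pose proof (q_ge1 n); apply Rmult_le_pos;
  [lra|apply pow_le, Rabs_pos].
Qed.

(** The derivative of x_(n+1) x_(n+2) contains q_(n+2) x_(n+1)^3, the source of the cubic bound. All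
    other terms are estimated by integrands whose time integrals are controlled (dissipation and
    absolute flux) or by small multiples of cubes. *)
Lemma product_derivative_ge (n : nat) (t d k : R) :
  0 <= t -> 0 <= d -> 0 <= k -> 1 <= 4 * d * k ->
  let x := fun m => u m t in
  L * (q (S n) * Rabs (x (S n)) ^ 3)
  + - (2 * K * L + 1 + P) * (p (S n) * x (S n) ^ 2)
  + - (1 + P) * (p (S (S n)) * x (S (S n)) ^ 2)
  + - (K * P ^ 2) * (p n * x n ^ 2)
  + - k * (q (S (S n)) * x (S n) ^ 2 * Rabs (x (S (S n))))
  + - k * (q (S (S (S n))) * x (S (S n)) ^ 2 * Rabs (x (S (S (S n)))))
  + - (d * L ^ 2) * (q (S n) * Rabs (x (S n)) ^ 3)
  + - d * (q (S (S n)) * Rabs (x (S (S n))) ^ 3)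
  + - d * (q (S (S (S n))) * Rabs (x (S (S (S n)))) ^ 3)
  <= dyadic_rhs p q x (S n) * x (S (S n))
     + x (S n) * dyadic_rhs p q x (S (S n)).
Proof.
intros Ht Hd Hk Hdk x; rewrite !dyadic_rhs_S, !p_S, !q_S.
pose proof (mode_lower_bound (S n) t Ht) as Hlow1.
pose proof (mode_lower_bound (S (S n)) t Ht) as Hlow2.
fold (x (S n)) in Hlow1; fold (x (S (S n))) in Hlow2.
pose proof (e_ge0 (S n)) as He1; pose proof (e_ge0 (S (S n))) as He2.
pose proof (qe_le (S n)) as HK1; pose proof (qe_le (S (S n))) as HK2.
rewrite p_S, q_S in HK1; rewrite !p_S, !q_S in HK2.
pose proof (p_ge1 n) as Hp; pose proof (q_ge1 n) as Hq.
set (x0 := x n) in *; set (x1 := x (S n)) in *.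
set (x2 := x (S (S n))) in *; set (x3 := x (S (S (S n)))) in *.
set (e1 := e (S n)) in *; set (e2 := e (S (S n))) in *.
set (p0 := p n) in *; set (q0 := q n) in *.
clearbody x0 x1 x2 x3 e1 e2 p0 q0.
assert (Hq1 : 1 <= L * q0) by nra.
assert (Hq2 : 1 <= L * (L * q0)) by nra.
assert (Hq3 : 1 <= L * (L * (L * q0))) by nra.
assert (Hp1 : 1 <= P * p0) by nra.
(* The cube and its absolute value differ only where [x1 < 0], and there [- x1 <= e1]. *)
assert (H1 : L * (L * q0) * (Rabs x1 ^ 3 - x1 ^ 3)
             <= 2 * K * L * (P * p0) * x1 ^ 2).
{ assert (Rabs x1 ^ 3 - x1 ^ 3 <= 2 * e1 * x1 ^ 2).
  { pose proof (pow2_ge_0 x1).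
    unfold Rabs; destruct (Rcase_abs x1); [|simpl in *; nra].
    replace ((- x1) ^ 3 - x1 ^ 3) with (2 * (- x1) * x1 ^ 2) by ring.
    apply Rmult_le_compat_r; lra. }
  apply Rle_trans with (L * (L * q0) * (2 * e1 * x1 ^ 2)).
  - apply Rmult_le_compat_l; lra.
  - apply (Rmult_le_compat_r (2 * L * x1 ^ 2)) in HK1; [lra|].
    apply Rmult_le_pos; [lra|apply pow2_ge_0]. }
(* The gain from mode [n] can be negative only as far as [x2] is, that is by at most [e2]. *)
assert (H2 : - (L * q0 * x0 ^ 2 * x2) <= K * P ^ 2 * p0 * x0 ^ 2).
{ apply (Rmult_le_compat_r (x0 ^ 2)) in HK2; [|apply pow2_ge_0].
  assert (0 <= L * q0 * x0 ^ 2) by (apply Rmult_le_pos; [lra|apply pow2_ge_0]).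
  assert (L * q0 * x0 ^ 2 * (- x2) <= L * q0 * x0 ^ 2 * e2)
    by (apply Rmult_le_compat_l; lra).
  assert (0 <= L * q0 * x0 ^ 2 * e2) by now apply Rmult_le_pos.
  assert (1 * (L * q0 * x0 ^ 2 * e2) <= L * (L * q0 * x0 ^ 2 * e2))
    by now apply Rmult_le_compat_r.
  lra. }
assert (H3 : (P * p0 + P * (P * p0)) * (x1 * x2)
             <= (1 + P) * (P * p0) * x1 ^ 2
                + (1 + P) * (P * (P * p0)) * x2 ^ 2).
{ assert (x1 * x2 <= x1 ^ 2 + x2 ^ 2).
  { pose proof (pow2_ge_0 (x1 - x2)); pose proof (pow2_ge_0 (x1 + x2)); lra. }
  assert (0 <= P * p0 + P * (P * p0)) by nra.
  assert ((P * p0 + P * (P * p0)) * (x1 * x2)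
          <= (P * p0 + P * (P * p0)) * (x1 ^ 2 + x2 ^ 2))
    by now apply Rmult_le_compat_l.
  assert (0 <= (1 + P) * (P * p0) * x2 ^ 2)
    by (apply Rmult_le_pos; [nra|apply pow2_ge_0]).
  assert (1 * ((1 + P) * (P * p0) * x2 ^ 2)
          <= P * ((1 + P) * (P * p0) * x2 ^ 2))
    by now apply Rmult_le_compat_r.
  lra. }
assert (H4 : L * (L * q0) * (x1 * x2 ^ 2)
             <= L * (L * q0) * (k * (x1 ^ 2 * Rabs x2) + d * Rabs x2 ^ 3)).
{ apply Rmult_le_compat_l; [lra|].
  rewrite <- (pow2_abs x1), <- (pow2_abs x2).
  apply Rle_trans with (Rabs x1 * Rabs x2 ^ 2).
  - apply Rmult_le_compat_r; [apply pow2_ge_0|apply Rle_abs].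
  - apply young_2; try apply Rabs_pos; assumption. }
assert (H5 : L * (L * (L * q0)) * (x1 * x2 * x3)
             <= L * (L * (L * q0)) *
                (k * (x2 ^ 2 * Rabs x3) + d * (Rabs x1 ^ 3 + Rabs x3 ^ 3))).
{ apply Rmult_le_compat_l; [lra|].
  rewrite <- (pow2_abs x2).
  apply Rle_trans with (Rabs x1 * Rabs x2 * Rabs x3).
  - rewrite <- !Rabs_mult; apply Rle_abs.
  - apply young_3; try apply Rabs_pos; assumption. }
lra.
Qed.

(** In order: the values of the product at the two end times, the dissipation terms, and the two
    flux terms of [cubic_recursion]. *)
Definition cubic_constant : R :=
  2 * l + (2 * K * L + 2 * (1 + P) + K * P ^ 2) * l
  + 4 * L ^ 2 * (l + K * P * l).

Lemma cubic_recursion (n : nat) (t : R) :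
  (1 <= n)%nat -> 0 <= t ->
  cubic n t <= 2 * cubic_constant
               + / (4 * L ^ 2) * (cubic (S n) t + cubic (S (S n)) t).
Proof.
intros Hn Ht; destruct n as [|n]; [lia|].
(* Then [d * L ^ 2] is 1/8, so the cube of mode [S n] produced by Young's inequality is absorbed on
   the left, leaving at least half of it. Doubling the inequality gives 2 d = 1 / (4 L^2), the
   factor wanted by [backward_recursion_bound]; [k] is fixed by 4 d k = 1. *)
pose (d := / (8 * L ^ 2)); pose (k := 2 * L ^ 2).
assert (HL2 : 1 <= L ^ 2) by nra.
assert (Hd : 0 < d) by (apply Rinv_0_lt_compat; lra).
assert (Hdk : 4 * d * k = 1) by (unfold d, k; field; lra).
assert (HdL : d * L ^ 2 = / 8) by (unfold d; field; lra).
pose proof (antideriv_mult _ _ _ _ (mode_antideriv (S n) ltac:(lia))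
  (mode_antideriv (S (S n)) ltac:(lia))) as Hprod.
assert (HG : antideriv
  (fun t => L * cubic (S n) t
    + - (2 * K * L + 1 + P) * dissipation (S n) t
    + - (1 + P) * dissipation (S (S n)) t
    + - (K * P ^ 2) * dissipation n t
    + - k * flux (S n) t
    + - k * flux (S (S n)) t
    + - (d * L ^ 2) * cubic (S n) t
    + - d * cubic (S (S n)) t
    + - d * cubic (S (S (S n))) t)
  (fun t => L * (q (S n) * Rabs (u (S n) t) ^ 3)
    + - (2 * K * L + 1 + P) * (p (S n) * u (S n) t ^ 2)
    + - (1 + P) * (p (S (S n)) * u (S (S n)) t ^ 2)
    + - (K * P ^ 2) * (p n * u n t ^ 2)
    + - k * (q (S (S n)) * u (S n) t ^ 2 * Rabs (u (S (S n)) t))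
    + - k * (q (S (S (S n))) * u (S (S n)) t ^ 2 * Rabs (u (S (S (S n))) t))
    + - (d * L ^ 2) * (q (S n) * Rabs (u (S n) t) ^ 3)
    + - d * (q (S (S n)) * Rabs (u (S (S n)) t) ^ 3)
    + - d * (q (S (S (S n))) * Rabs (u (S (S (S n))) t) ^ 3))).
{ pose proof cubic_antideriv; pose proof dissipation_antideriv.
  pose proof flux_antideriv.
  do 8 (apply antideriv_plus; [|now apply antideriv_scal]).
  now apply antideriv_scal. }
pose proof (antideriv_le _ _ _ _ 0 t HG Hprod ltac:(lra)) as Hle.
cbv beta in Hle.
assert (Hle' := Hle (fun s Hs => product_derivative_ge n s d k
  ltac:(lra) ltac:(lra) ltac:(unfold k; lra) ltac:(lra))); clear Hle.
assert (Hz : forall m, cubic m 0 = 0 /\ flux m 0 = 0 /\ dissipation m 0 = 0)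
  by (intros m; unfold cubic, flux, dissipation; now rewrite !RInt_0_0).
rewrite (proj1 (Hz (S n))), (proj1 (Hz (S (S n)))),
  (proj1 (Hz (S (S (S n))))) in Hle'.
rewrite (proj1 (proj2 (Hz (S n)))), (proj1 (proj2 (Hz (S (S n))))) in Hle'.
rewrite (proj2 (proj2 (Hz n))), (proj2 (proj2 (Hz (S n)))),
  (proj2 (proj2 (Hz (S (S n))))) in Hle'.
assert (Hup : forall m s, 0 <= s ->
  0 <= dissipation m s <= l /\ u m s ^ 2 <= l).
{ intros m s Hs; pose proof (mode_energy_le m s Hs).
  pose proof (dissipation_ge0 m s Hs); pose proof (pow2_ge_0 (u m s)); lra. }
assert (Hpt : u (S n) t * u (S (S n)) t - u (S n) 0 * u (S (S n)) 0 <= 2 * l).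
{ pose proof (proj2 (Hup (S n) t Ht)); pose proof (proj2 (Hup (S (S n)) t Ht)).
  pose proof (proj2 (Hup (S n) 0 (Rle_refl 0))).
  pose proof (proj2 (Hup (S (S n)) 0 (Rle_refl 0))).
  pose proof (pow2_ge_0 (u (S n) t - u (S (S n)) t)).
  pose proof (pow2_ge_0 (u (S n) 0 + u (S (S n)) 0)); lra. }
assert (HKL : 0 <= K * L) by nra.
assert (HKP : 0 <= K * P ^ 2) by (apply Rmult_le_pos; [lra|apply pow2_ge_0]).
assert (E1 : (2 * K * L + 1 + P) * dissipation (S n) t
             <= (2 * K * L + 1 + P) * l)
  by (apply Rmult_le_compat_l; [lra|apply Hup, Ht]).
assert (E2 : (1 + P) * dissipation (S (S n)) t <= (1 + P) * l)
  by (apply Rmult_le_compat_l; [lra|apply Hup, Ht]).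
assert (E3 : K * P ^ 2 * dissipation n t <= K * P ^ 2 * l)
  by (apply Rmult_le_compat_l; [lra|apply Hup, Ht]).
assert (E4 : k * flux (S n) t <= k * (l + K * P * l))
  by (apply Rmult_le_compat_l; [unfold k; lra|now apply flux_bound]).
assert (E5 : k * flux (S (S n)) t <= k * (l + K * P * l))
  by (apply Rmult_le_compat_l; [unfold k; lra|now apply flux_bound]).
pose proof (cubic_ge0 (S n) t Ht) as Hc.
assert (E6 : 1 * cubic (S n) t <= L * cubic (S n) t)
  by now apply Rmult_le_compat_r.
rewrite HdL in Hle'.
replace (/ (4 * L ^ 2)) with (2 * d) by (unfold d; field; lra).
unfold cubic_constant.
replace (4 * L ^ 2) with (2 * k) by (unfold k; ring).
lra.
Qed.

Lemma cubic_bounded (n : nat) (t : R) :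
  0 <= t -> cubic n t <= 4 * cubic_constant.
Proof.
intros Ht; pose proof l_nonneg as Hl.
assert (HC : 0 <= cubic_constant).
{ assert (0 <= K * L) by nra; assert (0 <= K * P) by nra.
  unfold cubic_constant; repeat apply Rplus_le_le_0_compat;
    repeat apply Rmult_le_pos; try apply pow2_ge_0; nra. }
destruct n as [|n].
- replace (cubic 0 t) with 0; [lra|].
  unfold cubic; rewrite (RInt_ext _ (fun _ => 0)).
  + rewrite RInt_const; symmetry; apply Rmult_0_r.
  + intros s _; rewrite u_0, Rabs_R0, pow_i by lia; apply Rmult_0_r.
- replace (4 * cubic_constant) with (2 * (2 * cubic_constant)) by ring.
  apply (backward_recursion_bound (fun n => cubic n t) q ((l + 1) * l) L);
    try assumption; try lia; try nra.
  + intros m; pose proof (q_ge1 m); lra.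
  + intros m _; now apply cubic_growth.
  + intros m Hm; now apply cubic_recursion.
Qed.

End OneCurve.

(** * Comparison of two solutions *)

(** In [qe_le_shift] the coefficient of [p n] is exactly 1: the sum of two solutions is at least
    [- 2 * e (S n)], and the viscous term [2 * p n] must absorb this. The finitely many modes where
    it falls short go into [c]. *)
Variable c : R.
Hypothesis c_ge0 : 0 <= c.
Hypothesis qe_le_shift : forall n, q (S n) * e (S n) <= p n + c.

(* The weights [2 ^ (- n)] make the cross terms telescope: each
   [w (n - 1) * w n] occurs with factor 1 in the equation of mode [n] and with
   factor [- 1 / 2] in that of mode [n - 1]. *)
Lemma weighted_difference_flux (x y : nat -> R) (N : nat) :
  x 0%nat = 0 -> y 0%nat = 0 ->
  sum1 (fun n => (/ 2) ^ n *
    (2 * (x n - y n) * (dyadic_rhs p q x n - dyadic_rhs p q y n))) N =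
  sum1 (fun n => (/ 2) ^ n *
    ((- 2 * p n - q (S n) * (x (S n) + y (S n))) * (x n - y n) ^ 2)) N
  - (/ 2) ^ N *
    (q (S N) * ((x N ^ 2 - y N ^ 2) * (x (S N) - y (S N)))).
Proof.
intros Hx Hy; induction N as [|N IH].
- rewrite !sum1_0, Hx, Hy; ring.
- rewrite !sum1_S, IH, !dyadic_rhs_S; simpl; field.
Qed.

(** Multiply [F] by exp (- b s); as [g] is nonnegative, the weight, at most 1, may be dropped from
    the forcing. *)
Lemma gronwall (F f G g : R -> R) (b t : R) :
  0 <= b -> 0 <= t -> antideriv F f -> antideriv G g ->
  (forall s, 0 < s < t -> 0 <= g s /\ f s <= b * F s + g s) ->
  F 0 = 0 -> F t <= exp (b * t) * (G t - G 0).
Proof.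
intros Hb Ht HF HG H H0.
assert (HE : antideriv (fun x => exp (- b * x))
                       (fun x => - b * exp (- b * x))).
{ split; intros x.
  - apply (ex_derive_continuous (fun x => exp (- b * x))); auto_derive; trivial.
  - intros _; auto_derive; [trivial|ring]. }
pose proof (antideriv_le _ _ _ _ 0 t (antideriv_mult _ _ _ _ HF HE) HG
  ltac:(lra)) as Hle; cbv beta in Hle.
rewrite H0, Rmult_0_l, Rminus_0_r in Hle.
assert (Hle' : F t * exp (- b * t) <= G t - G 0).
{ apply Hle; intros s Hs; destruct (H s Hs) as [Hg Hf].
  assert (He : exp (- b * s) <= 1).
  { rewrite <- exp_0; destruct (Req_dec (b * s) 0) as [Hbs|Hbs].
    - right; f_equal; lra.
    - left; apply exp_increasing; nra. }
  pose proof (exp_pos (- b * s)).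
  apply Rle_trans with (g s * exp (- b * s)).
  - apply (Rmult_le_compat_r (exp (- b * s))) in Hf; lra.
  - apply (Rmult_le_compat_l (g s)) in He; lra. }
apply (Rmult_le_compat_l (exp (b * t))) in Hle'; [|left; apply exp_pos].
replace (exp (b * t) * (F t * exp (- b * t)))
  with (F t * (exp (b * t) * exp (- b * t))) in Hle' by ring.
rewrite <- exp_plus in Hle'.
replace (b * t + - b * t) with 0 in Hle' by ring.
rewrite exp_0 in Hle'; lra.
Qed.

(** The product expands into four terms of the form square times factor, each bounded by two cubes;
    every cube occurs twice. *)
Lemma cubic_cross_bound (x y x' y' : R) :
  - ((x ^ 2 - y ^ 2) * (x' - y')) <=
  2 * (Rabs x ^ 3 + Rabs y ^ 3 + Rabs x' ^ 3 + Rabs y' ^ 3).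
Proof.
pose proof (sqr_mult_le_cubes _ _ (Rabs_pos x) (Rabs_pos x')).
pose proof (sqr_mult_le_cubes _ _ (Rabs_pos x) (Rabs_pos y')).
pose proof (sqr_mult_le_cubes _ _ (Rabs_pos y) (Rabs_pos x')).
pose proof (sqr_mult_le_cubes _ _ (Rabs_pos y) (Rabs_pos y')).
rewrite !pow2_abs in *.
assert (Hs : forall z w : R, - (z ^ 2 * Rabs w) <= z ^ 2 * w <= z ^ 2 * Rabs w).
{ intros z w; pose proof (pow2_ge_0 z); pose proof (Rle_abs w).
  pose proof (Rle_abs (- w)); rewrite Rabs_Ropp in *; split; nra. }
pose proof (Hs x x'); pose proof (Hs x y').
pose proof (Hs y x'); pose proof (Hs y y'); lra.
Qed.

Lemma weighted_difference_bound (u v : nat -> R -> R) (N : nat) (t : R) :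
  energy_curve p q a l u -> energy_curve p q a l v -> 0 <= t ->
  sum1 (fun n => (/ 2) ^ n * (u n t - v n t) ^ 2) N
  <= exp (2 * c * t) * ((/ 2) ^ N * (32 * (1 + L) * cubic_constant)).
Proof.
intros Hu Hv Ht.
pose (W := fun t => sum1 (fun n => (/ 2) ^ n * (u n t - v n t) ^ 2) N).
assert (HW : antideriv W (fun t => sum1 (fun n => (/ 2) ^ n *
  (2 * (u n t - v n t) * (dyadic_rhs p q (fun m => u m t) n
                          - dyadic_rhs p q (fun m => v m t) n))) N)).
{ apply (antideriv_sum1 (fun n t => (/ 2) ^ n * (u n t - v n t) ^ 2)
    (fun n t => (/ 2) ^ n *
       (2 * (u n t - v n t) * (dyadic_rhs p q (fun m => u m t) n
                               - dyadic_rhs p q (fun m => v m t) n)))).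
  intros n Hn; apply antideriv_scal.
  pose proof (antideriv_plus _ _ _ _ (mode_antideriv u Hu n Hn)
    (antideriv_scal _ _ (- 1) (mode_antideriv v Hv n Hn))) as Hw.
  eapply antideriv_ext; [| |exact (antideriv_mult _ _ _ _ Hw Hw)];
    intros; cbv beta; ring. }
assert (HG : antideriv
  (fun t => (/ 2) ^ N * 2 *
     (L * cubic u N t + L * cubic v N t + cubic u (S N) t + cubic v (S N) t))
  (fun t => (/ 2) ^ N * 2 *
     (L * (q N * Rabs (u N t) ^ 3) + L * (q N * Rabs (v N t) ^ 3)
      + q (S N) * Rabs (u (S N) t) ^ 3 + q (S N) * Rabs (v (S N) t) ^ 3))).
{ pose proof (cubic_antideriv u Hu); pose proof (cubic_antideriv v Hv).
  apply antideriv_scal; do 2 (apply antideriv_plus; [|easy]).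
  apply antideriv_plus; now apply antideriv_scal. }
assert (H2N : 0 < (/ 2) ^ N) by (apply pow_lt; lra).
assert (HW0 : W 0 = 0).
{ unfold W; transitivity (sum1 (fun _ => 0) N).
  - apply sum1_ext; intros n Hn.
    rewrite (proj1 (proj2 (proj2 Hu))), (proj1 (proj2 (proj2 Hv))) by lia; ring.
  - clear; induction N as [|N IH]; [apply sum1_0|rewrite sum1_S, IH; ring]. }
pose proof (gronwall _ _ _ _ (2 * c) t ltac:(lra) Ht HW HG) as Hgr.
cbv beta in Hgr.
eapply Rle_trans; [apply Hgr; [|exact HW0]|].
- intros s Hs; split.
  + pose proof (q_ge1 N); pose proof (q_ge1 (S N)).
    assert (Hc : forall z, 0 <= Rabs z ^ 3) by (intros; apply pow_le, Rabs_pos).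
    repeat apply Rmult_le_pos; try lra.
    repeat apply Rplus_le_le_0_compat; repeat apply Rmult_le_pos;
      try apply Rabs_pos; try apply Hc; lra.
  + rewrite (weighted_difference_flux (fun m => u m s) (fun m => v m s) N)
      by (apply Hu || apply Hv).
    (* First the quadratic form, bounded by [2 * c * W], then the boundary term at mode [N], bounded
       by cubes. *)
    apply Rplus_le_compat.
    * unfold W.
      assert (Hlin : 2 * c * sum1 (fun n => (/ 2) ^ n * (u n s - v n s) ^ 2) N =
        sum1 (fun n => 0 + 2 * c * ((/ 2) ^ n * (u n s - v n s) ^ 2)) N).
      { rewrite (sum1_lin (fun _ => 0)).
        replace (sum1 (fun _ => 0) N) with 0; [ring|].
        clear; induction N as [|N IH]; [now rewrite sum1_0|].
        rewrite sum1_S, <- IH; ring. }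
      rewrite Hlin; apply sum1_le; intros n Hn.
      pose proof (mode_lower_bound u Hu (S n) s ltac:(lra)) as Hlu.
      pose proof (mode_lower_bound v Hv (S n) s ltac:(lra)) as Hlv.
      specialize (qe_le_shift n) as Hsh; pose proof (q_ge1 (S n)).
      assert (H1 : q (S n) * - (2 * e (S n))
                   <= q (S n) * (u (S n) s + v (S n) s))
        by (apply Rmult_le_compat_l; lra).
      assert (H2 : (- 2 * p n - q (S n) * (u (S n) s + v (S n) s))
                   * (u n s - v n s) ^ 2 <= 2 * c * (u n s - v n s) ^ 2)
        by (apply Rmult_le_compat_r; [apply pow2_ge_0|lra]).
      assert (0 < (/ 2) ^ n) by (apply pow_lt; lra).
      apply (Rmult_le_compat_l ((/ 2) ^ n)) in H2; lra.
    * pose proof (cubic_cross_bound (u N s) (v N s) (u (S N) s) (v (S N) s))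
        as Hb.
      pose proof (q_ge1 (S N)).
      apply (Rmult_le_compat_l ((/ 2) ^ N * q (S N))) in Hb;
        [|apply Rmult_le_pos; lra].
      rewrite q_S in *; lra.
- apply Rmult_le_compat_l; [left; apply exp_pos|].
  unfold cubic at 5 6 7 8; rewrite !RInt_0_0.
  pose proof (cubic_bounded u Hu N t Ht) as B1.
  pose proof (cubic_bounded v Hv N t Ht) as B2.
  pose proof (cubic_bounded u Hu (S N) t Ht) as B3.
  pose proof (cubic_bounded v Hv (S N) t Ht) as B4.
  apply (Rmult_le_compat_l L) in B1; [|lra].
  apply (Rmult_le_compat_l L) in B2; [|lra].
  rewrite <- Rmult_minus_distr_l, Rmult_assoc.
  apply Rmult_le_compat_l; [lra|].
  assert (0 <= (1 + L) * cubic_constant); [|lra].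
  pose proof (cubic_ge0 u Hu N t Ht).
  assert (0 <= cubic_constant) by (pose proof (cubic_bounded u Hu N t Ht); lra).
  apply Rmult_le_pos; lra.
Qed.

(** A fixed mode is one term of the weighted sum for every [N >= n], while the bound on that sum is
    O(2^(- N)). *)
Theorem energy_curve_unique (u v : nat -> R -> R) (n : nat) (t : R) :
  energy_curve p q a l u -> energy_curve p q a l v ->
  (1 <= n)%nat -> 0 <= t -> u n t = v n t.
Proof.
intros Hu Hv Hn Ht.
assert (Hterm : (/ 2) ^ n * (u n t - v n t) ^ 2 <= 0).
{ set (z := (/ 2) ^ n * (u n t - v n t) ^ 2).
  pose (B := exp (2 * c * t)); pose (D := 32 * (1 + L) * cubic_constant).
  apply (is_lim_seq_le (fun _ => z) (fun k => B * ((/ 2) ^ (k + n) * D))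
    (Finite z) (Finite 0)).
  - intros k.
    eapply Rle_trans;
      [|exact (weighted_difference_bound u v (k + n) t Hu Hv Ht)].
    apply (sum1_term_le (fun n => (/ 2) ^ n * (u n t - v n t) ^ 2)); [|lia].
    intros m _; apply Rmult_le_pos; [apply pow_le; lra|apply pow2_ge_0].
  - apply is_lim_seq_const.
  - replace (Finite 0) with (Finite (B * (0 * D))) by (f_equal; ring).
    apply is_lim_seq_mult'; [apply is_lim_seq_const|].
    apply is_lim_seq_mult'; [|apply is_lim_seq_const].
    apply (is_lim_seq_incr_n (fun k => (/ 2) ^ k) n).
    apply is_lim_seq_geom; rewrite Rabs_pos_eq; lra. }
assert (0 < (/ 2) ^ n) by (apply pow_lt; lra).
assert ((u n t - v n t) ^ 2 <= 0).
{ apply Rmult_le_reg_l with ((/ 2) ^ n); lra. }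
assert (u n t - v n t = 0); [nra|lra].
Qed.

End EnergyCurves.

(** * The dyadic parameters *)

(** Takes care of the finitely many indices before an asymptotic estimate sets in. *)
Lemma finite_upper_bound (f : nat -> R) (N : nat) :
  exists B, 0 <= B /\ forall n, (n < N)%nat -> f n <= B.
Proof.
induction N as [|N [B [HB H]]]; [exists 0; split; [lra|lia]|].
exists (Rmax B (f N)); split; [eapply Rle_trans; [exact HB|apply Rmax_l]|].
intros n Hn; destruct (Nat.eq_dec n N) as [->|Hne]; [apply Rmax_r|].
eapply Rle_trans; [apply H; lia|apply Rmax_l].
Qed.

Lemma is_lim_seq_sum1 (f : nat -> R) :
  ex_series (fun n => f (S n)) ->
  is_lim_seq (sum1 f) (Series (fun n => f (S n))).
Proof.
intros Hf; apply is_lim_seq_incr_1.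
apply is_lim_seq_ext with (sum_n (fun n => f (S n))).
- intros n; apply sum_n_m_S.
- exact (Series_correct _ Hf).
Qed.

Lemma sum1_le_Series (f : nat -> R) (N : nat) :
  ex_series (fun n => f (S n)) -> (forall n, 0 <= f n) ->
  sum1 f N <= Series (fun n => f (S n)).
Proof.
intros Hf H0.
apply (is_lim_seq_le_loc (fun _ => sum1 f N) (sum1 f) (Finite (sum1 f N))
  (Finite (Series (fun n => f (S n))))).
- exists N; intros n Hn; now apply sum1_mono.
- apply is_lim_seq_const.
- now apply is_lim_seq_sum1.
Qed.

Lemma sum1_geometric_tail (f : nat -> R) (r d : R) (n M : nat) :
  r <> 1 -> (forall m, (n < m)%nat -> f m <= d * r ^ m) ->
  sum1 f (n + M) <= sum1 f n + d * (r ^ S n - r ^ (S n + M)) / (1 - r).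
Proof.
intros Hr H; induction M as [|M IH].
- rewrite !Nat.add_0_r; right; field; lra.
- rewrite <- !plus_n_Sm, sum1_S.
  specialize (H (S (n + M)) ltac:(lia)).
  replace (d * (r ^ S n - r ^ S (S n + M)) / (1 - r))
    with (d * (r ^ S n - r ^ (S n + M)) / (1 - r) + d * r ^ S (n + M)); [lra|].
  simpl; field; lra.
Qed.

Lemma sum1_geometric_tail_le (f : nat -> R) (r d : R) (n M : nat) :
  0 <= r < 1 -> 0 <= d -> (forall m, (n < m)%nat -> f m <= d * r ^ m) ->
  sum1 f (n + M) <= sum1 f n + d * r ^ S n / (1 - r).
Proof.
intros Hr Hd H.
eapply Rle_trans; [apply (sum1_geometric_tail f r d); [lra|exact H]|].
apply Rplus_le_compat_l; unfold Rdiv.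
apply Rmult_le_compat_r; [left; apply Rinv_0_lt_compat; lra|].
apply Rmult_le_compat_l; [exact Hd|].
assert (0 <= r ^ (S n + M)) by (apply pow_le; lra); lra.
Qed.

Lemma ex_series_geometric_tail (f : nat -> R) (r d : R) (n0 : nat) :
  0 <= r < 1 -> 0 <= d -> (forall n, 0 <= f n) ->
  (forall n, (n0 < n)%nat -> f n <= d * r ^ n) ->
  ex_series (fun n => f (S n)).
Proof.
intros Hr Hd H0 H.
destruct (ex_finite_lim_seq_incr (sum1 f)
  (sum1 f n0 + d * r ^ S n0 / (1 - r))) as [s Hs].
- intros n; rewrite sum1_S; specialize (H0 (S n)); lra.
- intros n; apply Rle_trans with (sum1 f (n0 + n)).
  + apply sum1_mono; [intros; apply H0|lia].
  + now apply sum1_geometric_tail_le.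
- exists s; change (is_lim_seq (sum_n (fun n => f (S n))) s).
  apply (is_lim_seq_ext (fun n => sum1 f (S n))).
  + intros n; symmetry; apply (sum_n_m_S f 0 n).
  + exact (proj1 (is_lim_seq_incr_1 (sum1 f) s) Hs).
Qed.

(** * Decay of the data against the coupling *)

Section DyadicData.

Variables lambda beta : R.
Variable a : nat -> R.
Hypothesis hlambda : 1 < lambda.
Hypothesis hbeta : 0 < beta.
Hypothesis ha_le : beta <= 2 -> in_l2 a.
Hypothesis ha_gt : 2 < beta ->
  is_domin eventually (fun n => Rpower lambda ((2 - beta) * INR n)) a.

Definition viscosity (n : nat) : R := lambda ^ (2 * n).
Definition coupling (n : nat) : R := Rpower lambda (beta * INR n).
Definition energy0 : R := Series (fun n => a (S n) ^ 2).
(* The sum of [a m ^ 2] over [m >= n]; the subtraction is truncated, so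
   [tail 0 = tail 1]. *)
Definition tail (n : nat) : R := energy0 - sum1 (fun m => a m ^ 2) (n - 1).

Lemma viscosity_Rpower (n : nat) : viscosity n = Rpower lambda (2 * INR n).
Proof.
unfold viscosity; rewrite <- Rpower_pow, mult_INR by lra; reflexivity.
Qed.

Lemma viscosity_S (n : nat) : viscosity (S n) = lambda ^ 2 * viscosity n.
Proof.
unfold viscosity; rewrite <- pow_add; f_equal; lia.
Qed.

Lemma coupling_S (n : nat) :
  coupling (S n) = Rpower lambda beta * coupling n.
Proof.
unfold coupling; rewrite <- Rpower_plus, S_INR; f_equal; ring.
Qed.

Lemma coupling_pos (n : nat) : 0 < coupling n.
Proof. apply exp_pos. Qed.

Lemma viscosity_pos (n : nat) : 0 < viscosity n.
Proof. apply pow_lt; lra. Qed.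

(** The ratio of the squares of lambda^((2 - beta) n): for beta > 2 the assumption reads a_n^2 =
    o([decay ^ n]). *)
Definition decay : R := Rpower lambda (2 * (2 - beta)).

Lemma decay_lt_1 : 2 < beta -> 0 < decay < 1.
Proof.
intros Hb; split; [apply exp_pos|].
unfold decay; rewrite <- (Rpower_O lambda) by lra.
apply Rpower_lt; lra.
Qed.

Lemma coupling_decay (n : nat) :
  coupling n ^ 2 * decay ^ n = viscosity n ^ 2.
Proof.
unfold decay; rewrite viscosity_Rpower; unfold coupling.
rewrite <- (Rpower_pow n) by apply exp_pos.
rewrite Rpower_mult; simpl; rewrite !Rmult_1_r, <- !Rpower_plus.
f_equal; ring.
Qed.

Lemma data_decay (d : R) :
  2 < beta -> 0 < d ->
  exists n0, forall n, (n0 <= n)%nat -> a n ^ 2 <= d * decay ^ n.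
Proof.
intros Hb Hd.
(* The root of [d], since the estimate is squared afterwards. *)
destruct (ha_gt Hb (mkposreal _ (sqrt_lt_R0 d Hd))) as [n0 H].
exists n0; intros n Hn; specialize (H n Hn); simpl in H.
change (Rabs (a n) <= sqrt d * Rabs (Rpower lambda ((2 - beta) * INR n))) in H.
rewrite (Rabs_pos_eq (Rpower _ _)) in H by (left; apply exp_pos).
rewrite <- (pow2_abs (a n)).
assert (Hsq : Rabs (a n) ^ 2
              <= (sqrt d * Rpower lambda ((2 - beta) * INR n)) ^ 2)
  by (apply pow_incr; split; [apply Rabs_pos|exact H]).
rewrite Rpow_mult_distr, pow2_sqrt in Hsq by lra.
replace (decay ^ n) with (Rpower lambda ((2 - beta) * INR n) ^ 2); [exact Hsq|].
unfold decay; rewrite <- !Rpower_pow, !Rpower_mult by apply exp_pos.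
f_equal; simpl; ring.
Qed.

Lemma data_in_l2 : in_l2 a.
Proof.
destruct (Rle_lt_dec beta 2) as [Hb|Hb]; [now apply ha_le|].
destruct (data_decay 1 Hb Rlt_0_1) as [n0 H].
apply (ex_series_geometric_tail (fun n => a n ^ 2) decay 1 n0).
- pose proof (decay_lt_1 Hb); lra.
- lra.
- intros; apply pow2_ge_0.
- intros n Hn; apply H; lia.
Qed.

Lemma tail_ge0 (n : nat) : 0 <= tail n.
Proof.
assert (sum1 (fun m => a m ^ 2) (n - 1) <= energy0); [|unfold tail; lra].
apply (sum1_le_Series (fun m => a m ^ 2));
  [apply data_in_l2|intros; apply pow2_ge_0].
Qed.

Lemma tail_geometric (d : R) (n : nat) :
  2 < beta -> 0 <= d ->
  (forall m, (S n <= m)%nat -> a m ^ 2 <= d * decay ^ m) ->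
  tail (S n) <= d * decay ^ S n / (1 - decay).
Proof.
intros Hb Hd H; pose proof (decay_lt_1 Hb).
assert (energy0 <= sum1 (fun m => a m ^ 2) n + d * decay ^ S n / (1 - decay)).
{ pose proof (is_lim_seq_sum1 (fun m => a m ^ 2) data_in_l2) as Hlim.
  apply (is_lim_seq_le_loc (sum1 (fun m => a m ^ 2))
    (fun _ => sum1 (fun m => a m ^ 2) n + d * decay ^ S n / (1 - decay))
    (Finite energy0)
    (Finite (sum1 (fun m => a m ^ 2) n + d * decay ^ S n / (1 - decay)))).
  - exists n; intros N HN; replace N with (n + (N - n))%nat by lia.
    apply sum1_geometric_tail_le; [lra|exact Hd|].
    intros m Hm; apply H; lia.
  - exact Hlim.
  - apply is_lim_seq_const. }
unfold tail; replace (S n - 1)%nat with n by lia; lra.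
Qed.

Lemma coupling_le_viscosity (n : nat) :
  beta <= 2 -> coupling n <= viscosity n.
Proof.
intros Hb; rewrite viscosity_Rpower.
destruct (Req_dec (beta * INR n) (2 * INR n)) as [Heq|Hne].
- right; unfold coupling; now rewrite Heq.
- left; unfold coupling; apply Rpower_lt; [exact hlambda|].
  pose proof (pos_INR n).
  assert (beta * INR n <= 2 * INR n) by now apply Rmult_le_compat_r.
  lra.
Qed.

(** For beta <= 2 the viscosity dominates the coupling and the tail tends to 0. For beta > 2 the
    tail inherits the geometric decay of the data, which [coupling_decay] matches exactly with the
    ratio of viscosity to coupling. *)
Lemma coupling_tail_small (eps : R) :
  0 < eps ->
  exists n0, forall n, (n0 <= n)%nat ->
    coupling n ^ 2 * tail n <= (eps * viscosity n) ^ 2.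
Proof.
intros Heps; destruct (Rle_lt_dec beta 2) as [Hb|Hb].
- pose proof (is_lim_seq_sum1 (fun m => a m ^ 2) data_in_l2) as Hlim.
  apply is_lim_seq_spec in Hlim.
  destruct (Hlim (mkposreal _ (pow_lt eps 2 Heps))) as [n0 H].
  exists (S n0); intros n Hn; specialize (H (n - 1)%nat ltac:(lia)).
  simpl in H; apply Rabs_def2 in H as [_ H].
  assert (Ht : tail n <= eps ^ 2) by (unfold tail, energy0; simpl; lra).
  rewrite Rpow_mult_distr, (Rmult_comm (eps ^ 2)).
  apply Rmult_le_compat; [apply pow2_ge_0|apply tail_ge0| |exact Ht].
  apply pow_incr; split;
    [left; apply coupling_pos|now apply coupling_le_viscosity].
- pose proof (decay_lt_1 Hb) as Hr.
  (* The factor [1 - decay] cancels the one from summing the geometric series. *)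
  destruct (data_decay (eps ^ 2 * (1 - decay)) Hb) as [n0 H].
  { apply Rmult_lt_0_compat; [apply pow_lt; exact Heps|lra]. }
  exists (S n0); intros n Hn; destruct n as [|n]; [lia|].
  rewrite Rpow_mult_distr, <- coupling_decay.
  apply Rle_trans with (coupling (S n) ^ 2 *
    (eps ^ 2 * (1 - decay) * decay ^ S n / (1 - decay))).
  + apply Rmult_le_compat_l; [apply pow2_ge_0|].
    apply tail_geometric; [exact Hb| |intros; apply H; lia].
    apply Rmult_le_pos; [apply pow2_ge_0|lra].
  + right; field; lra.
Qed.

Lemma coupling_sqrt_tail_small (eps : R) :
  0 < eps ->
  exists n0, forall n, (n0 <= n)%nat ->
    coupling n * sqrt (tail n) <= eps * viscosity n.
Proof.
intros Heps; destruct (coupling_tail_small eps Heps) as [n0 H].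
exists n0; intros n Hn; specialize (H n Hn).
pose proof (viscosity_pos n).
apply Rsqr_incr_0_var; [|nra].
rewrite !Rsqr_pow2, Rpow_mult_distr, pow2_sqrt by apply tail_ge0.
exact H.
Qed.

Lemma weak_solution_D_in (u : nat -> R -> R) (n : nat) (t : R) :
  weak_solution lambda beta a u -> (1 <= n)%nat -> 0 <= t ->
  D_in (u n) (fun t => dyadic_rhs viscosity coupling (fun m => u m t) n)
    halfline t.
Proof.
intros [_ Hw] Hn Ht; destruct (Hw n Hn) as [_ [_ [du Hdu]]].
destruct (Hdu t Ht) as [HD Heq]; apply (D_in_eq _ du); [|exact HD].
unfold dyadic_rhs, viscosity, coupling; lra.
Qed.

Lemma weak_solution_continuous (u : nat -> R -> R) (n : nat) (t : R) :
  weak_solution lambda beta a u -> continuous (fun x => u n (Rmax 0 x)) t.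
Proof.
intros Hw; destruct n as [|n].
- apply continuous_ext with (fun _ => 0); [|apply continuous_const].
  intros x; symmetry; apply (proj1 Hw), Rmax_l.
- eapply (D_in_halfline_continuous (u (S n))); intros s Hs.
  apply weak_solution_D_in; [exact Hw|lia|exact Hs].
Qed.

Lemma nonneg_sum_data : nonneg_sum (fun n => a n ^ 2) = Finite energy0.
Proof.
apply is_lim_seq_unique; exact (is_lim_seq_sum1 (fun m => a m ^ 2) data_in_l2).
Qed.

Lemma sum1_le_nonneg_sum (f : nat -> R) (N : nat) (B : R) :
  (forall n, 0 <= f n) -> Rbar_le (nonneg_sum f) B -> sum1 f N <= B.
Proof.
intros Hf HB.
assert (Hlim : is_lim_seq (sum1 f) (nonneg_sum f)).
{ apply (Lim_seq_correct (sum1 f)), ex_lim_seq_incr.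
  intros n; rewrite sum1_S; specialize (Hf (S n)); lra. }
apply (Rbar_le_trans (Finite (sum1 f N)) (nonneg_sum f) (Finite B));
  [|exact HB].
apply (is_lim_seq_le_loc (fun _ => sum1 f N) (sum1 f));
  [|apply is_lim_seq_const|exact Hlim].
exists N; intros n Hn; now apply sum1_mono.
Qed.

Lemma Leray_Hopf_energy_curve (u : nat -> R -> R) :
  Leray_Hopf_solution lambda beta a u ->
  energy_curve viscosity coupling a energy0 (fun n t => u n (Rmax 0 t)).
Proof.
intros [Hw HLH].
split; [|split; [|split; [|split]]].
- intros n t; now apply weak_solution_continuous.
- intros t; apply (proj1 Hw), Rmax_l.
- intros n Hn; rewrite Rmax_left by lra; now apply (proj2 Hw).
- intros n t Hn Ht.
  pose proof (antideriv_halfline (u n) _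
    (fun s Hs => weak_solution_D_in u n s Hw Hn Hs)) as [_ Hd].
  exact (Hd t Ht).
- intros N t Ht; specialize (HLH t Ht); rewrite nonneg_sum_data in HLH.
  eapply Rle_trans; [right; apply sum1_ext|apply sum1_le_nonneg_sum, HLH].
  + intros n _; cbv beta; rewrite (Rmax_right 0 t) by exact Ht.
    do 2 f_equal; exact (RInt_Rmax_ext (fun s => viscosity n * u n s ^ 2) t Ht).
  + intros n.
    assert (0 <= RInt (fun s => viscosity n * u n s ^ 2) 0 t).
    { rewrite <- (RInt_Rmax_ext (fun s => viscosity n * u n s ^ 2)) by exact Ht.
      apply (antideriv_ge0
        (fun t => RInt (fun s => viscosity n * u n (Rmax 0 s) ^ 2) 0 t)
        (fun s => viscosity n * u n (Rmax 0 s) ^ 2));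
        [|apply RInt_0_0|exact Ht|].
      - apply antideriv_RInt; intros s.
        apply (continuous_mult (K := R_AbsRing)); [apply continuous_const|].
        now apply (continuous_pow (fun s => u n (Rmax 0 s))),
          weak_solution_continuous.
      - intros s _; pose proof (viscosity_pos n).
        apply Rmult_le_pos; [lra|apply pow2_ge_0]. }
    pose proof (pow2_ge_0 (u n t)); unfold viscosity in *; lra.
Qed.

Lemma Leray_Hopf_exists : exists u, Leray_Hopf_solution lambda beta a u.
Proof.
destruct (dyadic_existence viscosity coupling a energy0) as
  [u [H0 [Hinit [HD HE]]]].
- intros n; left; apply viscosity_pos.
- intros n; left; apply coupling_pos.
- intros N; apply (sum1_le_Series (fun m => a m ^ 2));
    [apply data_in_l2|intros; apply pow2_ge_0].
- exists u; split; [split|].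
  + intros t _; apply H0.
  + intros n Hn; split; [|split; [now apply Hinit|]].
    * now apply (smooth_halfline_of_dyadic viscosity coupling).
    * exists (fun t => dyadic_rhs viscosity coupling (fun m => u m t) n).
      intros t Ht; split; [now apply HD|].
      unfold dyadic_rhs, viscosity, coupling; ring.
  + intros t Ht; rewrite nonneg_sum_data, <- (Lim_seq_const energy0).
    apply Lim_seq_le_loc; exists 0%nat; intros N _; exact (HE N t Ht).
Qed.

Lemma Leray_Hopf_unique (u v : nat -> R -> R) (n : nat) (t : R) :
  Leray_Hopf_solution lambda beta a u -> Leray_Hopf_solution lambda beta a v ->
  (1 <= n)%nat -> 0 <= t -> v n t = u n t.
Proof.
intros Hu Hv Hn Ht.
assert (HP : 0 < lambda ^ 2) by (apply pow_lt; lra).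
(* Smallness is used at two levels: [eps = 1] for [qe_le], and lambda^(- 2) for [qe_le_shift], where
   the shift from viscosity n + 1 to n costs the factor lambda^2. *)
destruct (coupling_sqrt_tail_small 1 Rlt_0_1) as [n1 H1].
destruct (coupling_sqrt_tail_small (/ lambda ^ 2)) as [n2 H2];
  [now apply Rinv_0_lt_compat|].
destruct (finite_upper_bound (fun n => coupling n * sqrt (tail n)) n1)
  as [K [HK HK1]].
destruct (finite_upper_bound (fun n => coupling n * sqrt (tail n)) n2)
  as [c [Hc Hc1]].
assert (Hv1 : forall m, 1 <= viscosity m)
  by (intros m; apply pow_R1_Rle; lra).
pose proof (energy_curve_unique viscosity coupling a (fun n => sqrt (tail n))
  energy0 (lambda ^ 2) (Rpower lambda beta) (K + 1)) as Huniq.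
specialize (Huniq ltac:(apply pow_R1_Rle; lra)).
specialize (Huniq ltac:(left; rewrite <- (Rpower_O lambda) by lra;
  now apply Rpower_lt)).
specialize (Huniq ltac:(lra) ltac:(reflexivity)).
specialize (Huniq ltac:(unfold coupling; simpl;
  rewrite Rmult_0_r; apply Rpower_O; lra) viscosity_S coupling_S).
specialize (Huniq (fun n => sqrt_pos _)).
assert (He : forall m, energy0 - sum1 (fun m => a m ^ 2) m
                       <= sqrt (tail (S m)) ^ 2).
{ intros m; rewrite pow2_sqrt by apply tail_ge0; unfold tail.
  replace (S m - 1)%nat with m by lia; lra. }
(* [K] covers the modes below [n1] and the added 1 those from [n1] on, as the viscosity is at least
   1. *)
assert (HKm : forall m, coupling m * sqrt (tail m) <= (K + 1) * viscosity m).
{ intros m; specialize (Hv1 m); destruct (le_lt_dec n1 m) as [Hm|Hm].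
  - specialize (H1 m Hm); nra.
  - specialize (HK1 m Hm); simpl in HK1; nra. }
assert (Hcm : forall m, coupling (S m) * sqrt (tail (S m)) <= viscosity m + c).
{ intros m; specialize (Hv1 m); destruct (le_lt_dec n2 (S m)) as [Hm|Hm].
  - specialize (H2 (S m) Hm); rewrite viscosity_S, <- Rmult_assoc in H2.
    rewrite Rinv_l in H2 by lra; lra.
  - specialize (Hc1 (S m) Hm); simpl in Hc1; lra. }
specialize (Huniq He HKm c Hc Hcm _ _ n t
  (Leray_Hopf_energy_curve v Hv) (Leray_Hopf_energy_curve u Hu) Hn Ht).
cbv beta in Huniq; rewrite Rmax_right in Huniq by exact Ht; exact Huniq.
Qed.

End DyadicData.

Theorem theorem0p7 (lambda beta : R) (a : nat -> R)
  (hlambda : 1 < lambda) (hbeta : 0 < beta)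
  (ha_le : beta <= 2 -> in_l2 a)
  (ha_gt : 2 < beta ->
     is_domin eventually (fun n => Rpower lambda ((2 - beta) * INR n)) a) :
  exists u : nat -> R -> R,
    Leray_Hopf_solution lambda beta a u /\
    forall v : nat -> R -> R,
      Leray_Hopf_solution lambda beta a v ->
      forall (n : nat) (t : R), (1 <= n)%nat -> 0 <= t -> v n t = u n t.
Proof.
destruct (Leray_Hopf_exists lambda beta a hlambda ha_le ha_gt) as [u Hu].
exists u; split; [exact Hu|]; intros v Hv n t Hn Ht.
now apply (Leray_Hopf_unique lambda beta a).
Qed.
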